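(* Let $q$ be a prime power. For any $\sigma\in\Sigma$, there is an affine isomorphism of convex cones $\mathcal P_0^{GL(\infty,q)}\to\mathcal P_\sigma^{GL(\infty,q)}$.
   Context: $\mathfrak{gl}(n,q)=\mathrm{Mat}_n(\mathbb F_q)$; $GL(\infty,q)=\varinjlim GL(n,q)$ (embedding $g\mapsto\mathrm{diag}(g,1)$). For $n\ge0$, $\mathbb L_n(q)$ is the set of infinite matrices $M=[m_{i,j}]_{i,j\ge1}$ over $\mathbb F_q$ with $m_{i,j}=0$ whenever $i\ge j$ and $i>n$, with the (compact) topology of entrywise convergence. $\mathbb L(q)=\bigcup_{n\ge0}\mathbb L_n(q)$ has the inductive limit topology (each $\mathbb L_n(q)$ is compact and open); $GL(\infty,q)$ acts on it by conjugation. $M^{\{n\}}$ denotes the upper-left $n\times n$ corner of $M$. For $s\ge0$, $\Sigma_s$ is the set of $GL(s,q)$-conjugacy classes of nonsingular matrices in $\mathfrak{gl}(s,q)$ ($\Sigma_0$ is a singleton), and $\Sigma=\bigsqcup_{s\ge0}\Sigma_s$. For $X\in\mathfrak{gl}(n,q)$, let $\mathbb F_q^n=V'\oplus V_0$ be the unique $X$-invariant decomposition with $X|_{V'}$ invertible and $X|_{V_0}$ nilpotent; the nonsingular type of $X$ is the class in $\Sigma_{\dim V'}$ of $X|_{V'}$. For $M\in\mathbb L(q)$ the nonsingular type of $M^{\{n\}}$ is constant for all sufficiently large $n$; this stable value is denoted $\sigma(M)$. Put $\mathbb L^\sigma(q)=\{M\in\mathbb L(q):\sigma(M)=\sigma\}$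 (a nonempty, invariant, clopen set). A Radon measure is a nonnegative Borel measure finite on compact sets. $\mathcal P_\sigma^{GL(\infty,q)}$ is the convex cone of $GL(\infty,q)$-invariant Radon measures on $\mathbb L(q)$ supported on $\mathbb L^\sigma(q)$ (vanishing outside it). $\mathcal P_0^{GL(\infty,q)}$ is the convex cone of $GL(\infty,q)$-invariant Radon measures supported on the set $\mathrm{Nil}(\mathbb L(q))=\bigcup_n\{M\in\mathbb L_n(q):M^{\{n\}}\text{ nilpotent}\}$ (it is $\mathcal P_\sigma^{GL(\infty,q)}$ for $\sigma$ the unique element of $\Sigma_0$). An affine isomorphism of convex cones is a bijection preserving sums and multiplication by nonnegative reals. *)

(* Defs.v *)
From HB Require Import structures.
From mathcomp Require Import all_boot all_order all_algebra.
From mathcomp Require Import all_classical all_reals all_analysis.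

Set Implicit Arguments.
Unset Strict Implicit.
Unset Printing Implicit Defensive.

Import Order.TTheory GRing.Theory Num.Theory.

Local Open Scope classical_set_scope.
Local Open Scope ring_scope.

(* Rows and columns are indexed from 0. The product of the discrete
   topologies is the topology of entrywise convergence. *)
Definition infmx (F : finFieldType) : Type :=
  {ptws nat -> {ptws nat -> discrete_topology F}}.

HB.instance Definition _ (F : finFieldType) := Topological.on (infmx F).

Definition entry (F : finFieldType) (M : infmx F) (i j : nat) : F := M i j.

(* With indices from 0, the condition "i >= j and i > n" on 1-based indices
   reads "j <= i and n <= i". *)
Definition Ln (F : finFieldType) (n : nat) : set (infmx F) :=
  [set M | forall i j : nat, (j <= i)%N -> (n <= i)%N -> entry M i j = 0].

(* A record rather than a set_type, because the topology of the union is not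
   the one induced by infmx. *)
Record Linf (F : finFieldType) : Type :=
  MkLinf { Lmx :> infmx F; LmxP : exists n, Ln n Lmx }.

Definition Ln_incl (F : finFieldType) (n : nat) (M : set_type (@Ln F n)) :
    Linf F :=
  MkLinf (ex_intro (fun m => Ln m (set_val M)) n (set_valP M)).

HB.instance Definition _ (F : finFieldType) := gen_eqMixin (Linf F).
HB.instance Definition _ (F : finFieldType) := gen_choiceMixin (Linf F).

(* Inductive limit topology; each Ln n, as a set_type, carries the topology
   induced by infmx. *)
Definition Linf_open (F : finFieldType) : set_system (Linf F) :=
  [set U | forall n, open (@Ln_incl F n @^-1` U)].

Lemma Linf_openT (F : finFieldType) : Linf_open [set: Linf F].
Proof. by move=> n; rewrite preimage_setT; exact: openT. Qed.

Lemma Linf_openI (F : finFieldType) : setI_closed (@Linf_open F).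
Proof. by move=> A B oA oB n; rewrite preimage_setI; exact: openI. Qed.

Lemma Linf_open_bigU (F : finFieldType) (I : Type) (f : I -> set (Linf F)) :
  (forall i, Linf_open (f i)) -> Linf_open (\bigcup_i f i).
Proof.
move=> of_ n; rewrite preimage_bigcup; apply: bigcup_open => i _; exact: of_.
Qed.

HB.instance Definition _ (F : finFieldType) :=
  isOpenTopological.Build (Linf F)
    (@Linf_openT F) (@Linf_openI F) (@Linf_open_bigU F).

Lemma Ln0 (F : finFieldType) : Ln 0 ((fun _ _ => 0) : infmx F).
Proof. by []. Qed.

HB.instance Definition _ (F : finFieldType) :=
  isPointed.Build (Linf F) (MkLinf (ex_intro _ 0%N (Ln0 F))).

Notation LinfB F := (g_sigma_algebraType (@open (Linf F))).

(* diag(u, 1, 1, ...) *)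
Definition diag1 (F : finFieldType) (n : nat) (u : 'M[F]_n) : infmx F :=
  fun i j => match insub i, insub j with
             | Some i', Some j' => u i' j'
             | _, _ => (i == j)%:R
             end.

(* The sum over a classical set is 0 by convention when infinitely many terms
   are nonzero; below, one factor is always diag(u, 1, 1, ...), so that every
   sum has finite support. *)
Definition infmul (F : finFieldType) (A B : infmx F) : infmx F :=
  fun i j => \sum_(k \in [set: nat]) entry A i k * entry B k j.

Definition infconj (F : finFieldType) (n : nat) (u : 'M[F]_n) (M : infmx F) :
    infmx F :=
  infmul (infmul (diag1 u) M) (diag1 (invmx u)).

Lemma diag1_out (F : finFieldType) (n : nat) (u : 'M[F]_n) (i j : nat) :
  (n <= maxn i j)%N -> entry (diag1 u) i j = (i == j)%:R.
Proof.
rewrite leq_max /entry /diag1 => /orP[] h; case: insubP => //= i' hi' ei'.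
  by move: hi'; rewrite ltnNge h.
by case: insubP => //= j' hj' ej'; move: hj'; rewrite ltnNge h.
Qed.

Lemma infconjP (F : finFieldType) (n : nat) (u : 'M[F]_n) (M : infmx F) :
  (exists m, Ln m M) -> exists m, Ln m (infconj u M).
Proof.
move=> [m Mm]; exists (maxn n m) => i j ji; rewrite geq_max => /andP[ni mi].
apply: fsbig1 => l _.
have [li|il] := leqP l i; last first.
  rewrite (@diag1_out _ _ (invmx u)); last first.
    by rewrite leq_max (leq_trans ni (ltnW il)).
  by rewrite gtn_eqF ?mulr0// (leq_ltn_trans ji).
rewrite [X in X * _](_ : _ = 0) ?mul0r//; apply: fsbig1 => k _.
rewrite diag1_out ?leq_max ?ni//.
by have [<-|] := eqVneq i k; rewrite ?mul0r// Mm ?mulr0.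
Qed.

(* Action of the class of u : GL(n, q) in the direct limit GL(oo, q); the
   value for singular u is irrelevant. *)
Definition GLact (F : finFieldType) (n : nat) (u : 'M[F]_n) (M : Linf F) :
    Linf F :=
  MkLinf (infconjP u (LmxP M)).

Definition corner (F : finFieldType) (n : nat) (M : Linf F) : 'M[F]_n :=
  \matrix_(i < n, j < n) entry M i j.

Definition conjclass (F : finFieldType) (s : nat) (X : 'M[F]_s) :
    set 'M[F]_s :=
  [set u *m X *m invmx u | u in [set u | u \in unitmx]].

Record Sigma (F : finFieldType) : Type := MkSigma {
  sdim : nat;
  sclass : set 'M[F]_sdim;
  sclassP : exists2 X : 'M[F]_sdim, X \in unitmx & sclass = conjclass X }.

Definition mxend (F : finFieldType) (n : nat) (X : 'M[F]_n) :
    'End('cV[F]_n) := linfun (mulmx X).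

Definition fitting (F : finFieldType) (n : nat) (X : 'M[F]_n)
    (V' V0 : {vspace 'cV[F]_n}) : Prop :=
  [/\ (V' + V0)%VS = fullv /\ (V' :&: V0)%VS = 0%VS,
      (mxend X @: V' <= V')%VS /\ (mxend X @: V0 <= V0)%VS,
      {in V' &, injective (mxend X)} /\ (mxend X @: V')%VS = V'
    & exists k : nat, forall v, v \in V0 -> iter k (mxend X) v = 0].

(* In a basis b of V', the matrix Y of the restriction of X to V' belongs to
   the class sigma; column j of Y holds the coordinates of X b_j. *)
Definition nonsing_type (F : finFieldType) (n : nat) (X : 'M[F]_n)
    (sigma : Sigma F) : Prop :=
  exists V' V0 : {vspace 'cV[F]_n}, fitting X V' V0 /\
  exists2 b : (sdim sigma).-tuple 'cV[F]_n, basis_of V' b &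
  exists2 Y : 'M[F]_(sdim sigma), sclass Y &
    forall j, mxend X (tnth b j) = \sum_i Y i j *: tnth b i.

Definition Lsigma (F : finFieldType) (sigma : Sigma F) : set (LinfB F) :=
  [set M | exists N : nat, forall n : nat, (N <= n)%N ->
    nonsing_type (corner n M) sigma].

Definition nilpotent_mx (F : finFieldType) (n : nat) (X : 'M[F]_n) : Prop :=
  exists k : nat, X ^+ k = 0.

Definition NilL (F : finFieldType) : set (LinfB F) :=
  [set M : LinfB F | exists n : nat,
    Ln n (Lmx M) /\ nilpotent_mx (corner n M)].

Definition radon (F : finFieldType) (R : realType)
    (mu : {measure set (LinfB F) -> \bar R}) : Prop :=
  forall K : set (Linf F), compact K -> (mu K < +oo)%E.

Definition GL_invariant (F : finFieldType) (R : realType)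
    (mu : {measure set (LinfB F) -> \bar R}) : Prop :=
  forall (n : nat) (u : 'M[F]_n), u \in unitmx ->
  forall A : set (LinfB F), measurable A -> mu (GLact u @^-1` A) = mu A.

Definition cone_on (F : finFieldType) (R : realType) (S : set (LinfB F)) :
    set {measure set (LinfB F) -> \bar R} :=
  [set mu | [/\ radon mu, GL_invariant mu & mu (~` S) = 0%E]].

Definition P0 (F : finFieldType) (R : realType) := @cone_on F R (@NilL F).

Definition Psigma (F : finFieldType) (R : realType) (sigma : Sigma F) :=
  @cone_on F R (Lsigma sigma).

(* A {measure set T -> \bar R} is a function on all sets, including the
   non-measurable ones, so equality of measures is equality on measurable
   sets. *)
Definition meas_eq (d : measure_display) (T : measurableType d) (R : realType)
    (mu nu : {measure set T -> \bar R}) : Prop :=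
  forall A : set T, measurable A -> mu A = nu A.

(* Phi induces an affine bijection between the cones C and D, measures being
   identified when they agree on measurable sets. *)
Definition affine_iso (d : measure_display) (T : measurableType d)
    (R : realType) (C D : set {measure set T -> \bar R})
    (Phi : {measure set T -> \bar R} -> {measure set T -> \bar R}) : Prop :=
  [/\ forall mu, C mu -> D (Phi mu),
      forall mu nu, C mu -> C nu ->
        (meas_eq (Phi mu) (Phi nu) <-> meas_eq mu nu),
      forall nu, D nu -> exists2 mu, C mu & meas_eq (Phi mu) nu,
      forall mu nu, C mu -> C nu ->
        meas_eq (Phi (measure_add mu nu)) (measure_add (Phi mu) (Phi nu))
    & forall (c : {nonneg R}) mu, C mu ->
        meas_eq (Phi (mscale c mu)) (mscale c (Phi mu))].

(* Main.v *)
(* A measure in either cone is determined by the masses [phi X] of the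
   cylinders [cyl X], made of the matrices of [Ln n] with n-corner [X].  The
   arrays [phi] that occur are the nonnegative class functions, supported on
   the prescribed type of corners, such that [phi X] is the sum over the
   columns [x] of [phi [X x; 0 0]]; conversely such an array extends to a
   measure, since cylinders are compact and open.  If [Y] is invertible of size
   [s], then [Y (+) N] bordered by the column [(x', x)] is similar to
   [Y (+) [N x; 0 0]] whatever [x'] is, so the recursion on the type of [Y]
   differs from the recursion on nilpotent matrices by a factor [q ^ s] at each
   step.  Hence [psi (Y (+) N) = q ^ (- s n) phi N], for [N] nilpotent of size
   [n], matches the arrays of the two cones. *)

Require Import Defs.
From HB Require Import structures.
From mathcomp Require Import all_boot all_order all_algebra finmap.
From mathcomp Require Import all_classical all_reals all_analysis.

Set Implicit Arguments.
Unset Strict Implicit.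
Unset Printing Implicit Defensive.

Import Order.TTheory GRing.Theory Num.Theory.

Local Open Scope classical_set_scope.
Local Open Scope ring_scope.

(** * Matrices up to similarity *)

Section RectangularSimilarity.
Variable F : finFieldType.

(* Similarity through rectangular matrices: it forces [m = n], but spares the
   casts between 'M_(s + n + 1) and 'M_(s + (n + 1)). *)
Definition mxsim (m n : nat) (X : 'M[F]_m) (Z : 'M[F]_n) :=
  exists (P : 'M[F]_(m, n)) (Q : 'M[F]_(n, m)),
    [/\ P *m Q = 1%:M, Q *m P = 1%:M & X *m P = P *m Z].

Definition dsum (m n : nat) (X : 'M[F]_m) (Z : 'M[F]_n) : 'M[F]_(m + n) :=
  block_mx X 0 0 Z.

(** The next corner of a matrix of [Ln m] with corner [X]: row [m] vanishes up to the diagonal, and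
    only the new column is free. *)
Definition ext (m : nat) (X : 'M[F]_m) (x : 'cV[F]_m) : 'M[F]_(m + 1) :=
  block_mx X x 0 0.

Lemma mxsim_refl m (X : 'M[F]_m) : mxsim X X.
Proof. by exists 1%:M, 1%:M; split; rewrite ?mulmx1 ?mul1mx. Qed.

Lemma mxsim_sym m n (X : 'M[F]_m) (Z : 'M[F]_n) : mxsim X Z -> mxsim Z X.
Proof.
move=> [P [Q [PQ QP XP]]]; exists Q, P; split=> //.
by rewrite -[LHS]mul1mx -QP -!mulmxA (mulmxA P) -XP -!mulmxA PQ mulmx1.
Qed.

Lemma mxsim_trans m n p (X : 'M[F]_m) (Z : 'M[F]_n) (W : 'M[F]_p) :
  mxsim X Z -> mxsim Z W -> mxsim X W.
Proof.
move=> [P [Q [PQ QP XP]]] [P' [Q' [PQ' QP' XP']]]; exists (P *m P'), (Q' *m Q).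
split; last by rewrite mulmxA XP -mulmxA XP' mulmxA.
- by rewrite mulmxA -(mulmxA P) PQ' mulmx1.
- by rewrite mulmxA -(mulmxA Q') QP mulmx1.
Qed.

Lemma mxsim_size m n (X : 'M[F]_m) (Z : 'M[F]_n) : mxsim X Z -> m = n.
Proof.
move=> [P [Q [PQ QP _]]]; apply/eqP; rewrite eqn_leq.
by rewrite (mulmx1_min PQ) (mulmx1_min QP).
Qed.

Lemma mxsim_conj m (u X : 'M[F]_m) :
  u \in unitmx -> mxsim (u *m X *m invmx u) X.
Proof.
by move=> uu; exists u, (invmx u); split; rewrite ?mulmxV ?mulVmx ?mulmxKV.
Qed.

Lemma mxsimP m (X Z : 'M[F]_m) :
  mxsim X Z -> exists2 u, u \in unitmx & X = u *m Z *m invmx u.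
Proof.
move=> [P [Q [PQ QP XP]]]; have Pu := (mulmx1_unit PQ).1.
by exists P => //; rewrite -XP mulmxK.
Qed.

Lemma mxsim_dsum m n m' n' (X : 'M[F]_m) (Z : 'M[F]_n) (X' : 'M[F]_m')
    (Z' : 'M[F]_n') :
  mxsim X X' -> mxsim Z Z' -> mxsim (dsum X Z) (dsum X' Z').
Proof.
move=> [P [Q [PQ QP XP]]] [P' [Q' [PQ' QP' XP']]].
exists (block_mx P 0 0 P'), (block_mx Q 0 0 Q').
rewrite /dsum !mulmx_block !(mulmx0, mul0mx, addr0, add0r).
by rewrite PQ QP PQ' QP' XP XP' !scalar_mx_block.
Qed.

Lemma expmx_mul m n (X : 'M[F]_m) (Z : 'M[F]_n) (P : 'M[F]_(m, n)) k :
  X *m P = P *m Z -> X ^+ k *m P = P *m Z ^+ k.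
Proof.
move=> XP; elim: k => [|k IH].
  by rewrite !expr0 (mul1mx P) (mulmx1 P).
by rewrite !exprSr -!mulmxE -mulmxA XP !mulmxA IH.
Qed.

Lemma mxsim_nil m n (X : 'M[F]_m) (Z : 'M[F]_n) :
  mxsim X Z -> nilpotent_mx X -> nilpotent_mx Z.
Proof.
move=> [P [Q [PQ QP XP]]] [k Xk]; exists k.
by rewrite -[LHS]mul1mx -QP -mulmxA -(expmx_mul _ XP) Xk mul0mx mulmx0.
Qed.

(** * Uniqueness of the splitting into an invertible and a nilpotent block *)

Lemma unitmxX m (A : 'M[F]_m) k : A \in unitmx -> A ^+ k \in unitmx.
Proof.
move=> Au; elim: k => [|k IH]; first by rewrite expr0 unitmx1.
by rewrite exprS -mulmxE unitmx_mul Au.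
Qed.

(** A power of [N] vanishes and powers are intertwined too, so an invertible power of [A] kills
    [b]. *)
Lemma intertwine_unit_nil m n (A : 'M[F]_m) (N : 'M[F]_n) (b : 'M[F]_(m, n)) :
  A \in unitmx -> nilpotent_mx N -> A *m b = b *m N -> b = 0.
Proof.
move=> Au [k Nk] /(expmx_mul k); rewrite Nk mulmx0 => Akb.
by rewrite -(mulKmx (unitmxX k Au) b) Akb mulmx0.
Qed.

Lemma intertwine_nil_unit m n (A : 'M[F]_m) (N : 'M[F]_n) (c : 'M[F]_(n, m)) :
  A \in unitmx -> nilpotent_mx N -> N *m c = c *m A -> c = 0.
Proof.
move=> Au [k Nk] /(expmx_mul k); rewrite Nk mul0mx => cAk.
by rewrite -(mulmxK (unitmxX k Au) c) -cAk mul0mx.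
Qed.

Lemma intertwine_dsum m n m' n' (A : 'M[F]_m) (N : 'M[F]_n) (A' : 'M[F]_m')
    (N' : 'M[F]_n') (P : 'M[F]_(m + n, m' + n')) :
  A \in unitmx -> A' \in unitmx -> nilpotent_mx N -> nilpotent_mx N' ->
  dsum A N *m P = P *m dsum A' N' ->
  exists a d, [/\ P = block_mx a 0 0 d, A *m a = a *m A' & N *m d = d *m N'].
Proof.
move=> Au Au' Nn Nn'; rewrite -{1 2}[P]submxK /dsum !mulmx_block.
rewrite !(mulmx0, mul0mx, addr0, add0r).
move=> /eq_block_mx[eqa /(intertwine_unit_nil Au Nn') b0
  /(intertwine_nil_unit Au' Nn) c0 eqd].
by exists (ulsubmx P), (drsubmx P); rewrite -{1}[P]submxK b0 c0.
Qed.

(** The off-diagonal blocks of [P] and [Q] intertwine an invertible matrix with a nilpotent one,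
    hence vanish; the diagonal blocks are then mutually inverse. *)
Lemma mxsim_dsum_inv m n m' n' (A : 'M[F]_m) (N : 'M[F]_n) (A' : 'M[F]_m')
    (N' : 'M[F]_n') :
  A \in unitmx -> A' \in unitmx -> nilpotent_mx N -> nilpotent_mx N' ->
  mxsim (dsum A N) (dsum A' N') -> mxsim A A' /\ mxsim N N'.
Proof.
move=> Au Au' Nn Nn' [P [Q [PQ QP XP]]].
have QX : dsum A' N' *m Q = Q *m dsum A N.
  by rewrite -[LHS]mul1mx -QP -!mulmxA (mulmxA P) -XP -!mulmxA PQ mulmx1.
have [a [d [Pe aA dN]]] := intertwine_dsum Au Au' Nn Nn' XP.
have [a' [d' [Qe aA' dN']]] := intertwine_dsum Au' Au Nn' Nn QX.
move: PQ QP; rewrite Pe Qe !mulmx_block !(mulmx0, mul0mx, addr0, add0r).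
rewrite !scalar_mx_block => /eq_block_mx[aa' _ _ dd'].
move=> /eq_block_mx[a'a _ _ d'd].
by split; [exists a, a'|exists d, d'].
Qed.

(** Conjugation by [P (+) 1] moves the border by [Q]. The inverse of [Q] is recorded because sums
    over all columns will be reindexed along it. *)
Lemma mxsim_ext m n (X : 'M[F]_m) (Z : 'M[F]_n) :
  mxsim X Z -> exists2 Q : 'M[F]_(n, m),
    exists P : 'M[F]_(m, n), P *m Q = 1%:M /\ Q *m P = 1%:M &
    forall x, mxsim (ext X x) (ext Z (Q *m x)).
Proof.
move=> [P [Q [PQ QP XP]]]; exists Q; first by exists P.
move=> x; exists (block_mx P 0 0 1%:M), (block_mx Q 0 0 1%:M).
rewrite /ext !mulmx_block !(mulmx0, mul0mx, addr0, add0r, mulmx1).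
by rewrite mulmxA PQ QP XP mul1mx !scalar_mx_block.
Qed.

Lemma mxsim_cast m n (e : m = n) (X : 'M[F]_m) : mxsim (castmx (e, e) X) X.
Proof. by case: n / e; rewrite castmx_id; exact: mxsim_refl. Qed.

(* The column [x'] over the invertible block [A] is killed by the change of
   basis adding [- A^-1 x'] to the last vector. *)
Lemma mxsim_ext_dsum s n (A : 'M[F]_s) (N : 'M[F]_n) (x' : 'cV[F]_s)
    (x : 'cV[F]_n) : A \in unitmx ->
  mxsim (ext (dsum A N) (col_mx x' x)) (dsum A (ext N x)).
Proof.
move=> Au; apply: (@mxsim_trans _ _ _ _ (ext (dsum A N) (col_mx 0 x))).
  pose u := invmx A *m x'.
  exists (block_mx 1%:M (- col_mx u 0) 0 1%:M).
  exists (block_mx 1%:M (col_mx u 0) 0 1%:M).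
  rewrite /ext !mulmx_block !(mulmx0, mul0mx, addr0, add0r, mulmx1, mul1mx).
  rewrite subrr addNr -scalar_mx_block; split=> //; congr block_mx.
  rewrite mulmxN mul_block_col !(mulmx0, mul0mx, addr0) mulKVmx//.
  by rewrite opp_col_mx add_col_mx addNr oppr0 add0r.
(* Only the bracketing of the blocks is left to change, from [(s + n) + 1] to [s + (n + 1)]. *)
have := @block_mxAx F s n 1 s n 1 A 0 0 0 N x 0 0 0.
rewrite /= !row_mx0 !col_mx0 -/(ext N x) -/(dsum A N) -/(ext _ _) => e.
rewrite -/(dsum A (ext N x)) in e; rewrite {}e; exact/mxsim_sym/mxsim_cast.
Qed.

(** * Existence of the splitting into an invertible and a nilpotent block *)

Lemma mxsim_unit m (X : 'M[F]_m) : mxsim X (dsum X (0 : 'M[F]_0)).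
Proof.
exists (row_mx 1%:M 0), (col_mx 1%:M 0); split.
- by rewrite mul_row_col mulmx1 mulmx0 addr0.
- rewrite mul_col_row !(mulmx0, mul0mx, mulmx1) scalar_mx_block.
  by congr block_mx; rewrite [RHS]flatmx0.
- by rewrite mul_row_block mul_mx_row !(mulmx0, mulmx1, mul1mx, addr0).
Qed.

(** A left null vector, completed to a basis, produces a zero row, which is then moved to the last
    place. *)
Lemma mxsim_singular m (X : 'M[F]_m.+1) : X \notin unitmx ->
  exists (X' : 'M[F]_m) x, mxsim X (ext X' x).
Proof.
move=> Xu; have [u u0 uX] : exists2 u : 'rV[F]_m.+1, u != 0 & u *m X = 0.
  have : kermx X != 0 by rewrite kermx_eq0 row_free_unit.
  by move=> /rowV0Pn[u /sub_kermxP uX u0]; exists u.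
(* The first row of this invertible matrix is a nonzero multiple of [u], so the first row of
   [R *m X] is zero. *)
pose R : 'M[F]_(1 + m) := row_ebase u.
have Ru : R \in unitmx := row_ebase_unit u.
pose Z : 'M[F]_(1 + m) := R *m X *m invmx R.
have ru : \rank u = 1%N by rewrite rank_rV u0.
have Z0 : usubmx Z = 0.
  have : row_mx 1%:M 0 *m (R *m X) = 0 :> 'rV[F]_(1 + m).
    have -> : row_mx 1%:M 0 = pid_mx 1 :> 'rV[F]_(1 + m).
      by rewrite pid_mx_row.
    move: uX; rewrite -{1}(mulmx_ebase u) ru -2!mulmxA.
    move=> /(congr1 (mulmx (invmx (col_ebase u)))).
    by rewrite mulmx0 mulKmx ?col_ebase_unit// mulmxA.
  move=> RX; have <- : row_mx 1%:M 0 *m Z = usubmx Z.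
    by rewrite -{1}[Z]vsubmxK mul_row_col mul1mx mul0mx addr0.
  by rewrite mulmxA RX mul0mx.
have [x [X' Ze]] : exists x X', Z = block_mx 0 0 x X'.
  exists (lsubmx (dsubmx Z)), (rsubmx (dsubmx Z)).
  by rewrite /block_mx row_mx0 hsubmxK -Z0 vsubmxK.
exists X', x; apply: (@mxsim_trans _ (1 + m) _ _ Z).
  exact/mxsim_sym/mxsim_conj.
(* Exchanging the two blocks of coordinates sends the zero row from the top to the bottom. *)
exists (block_mx 0 1%:M 1%:M 0), (block_mx 0 1%:M 1%:M 0).
rewrite Ze /ext !mulmx_block.
rewrite !(mulmx0, mul0mx, addr0, add0r, mulmx1, mul1mx).
by rewrite -!scalar_mx_block.
Qed.

Lemma ext_exprS m (X : 'M[F]_m) (x : 'cV[F]_m) k :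
  ext X x ^+ k.+1 = block_mx (X ^+ k.+1) (X ^+ k *m x) 0 0.
Proof.
elim: k => [|k IH]; first by rewrite !expr1 expr0 [X in block_mx _ X _ _]mul1mx.
rewrite exprS IH -mulmxE mulmx_block !(mulmx0, mul0mx, addr0) mulmxA.
by rewrite mulmxE -!exprS.
Qed.

Lemma nilpotent_ext m (X : 'M[F]_m) (x : 'cV[F]_m) :
  nilpotent_mx (ext X x) <-> nilpotent_mx X.
Proof.
split=> [[k Xk]|[k Xk]].
  have : ext X x ^+ k.+1 = 0 by rewrite exprS Xk mulr0.
  rewrite ext_exprS -[0 in RHS]block_mx0 => /eq_block_mx[Xk0 _ _ _].
  by exists k.+1.
by exists k.+1; rewrite ext_exprS exprS Xk mulr0 mul0mx block_mx0.
Qed.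

(** Induction on the size: an invertible matrix takes an empty nilpotent block, while a singular one
    is a bordered smaller matrix, and bordering only enlarges the nilpotent block. *)
Lemma fitting_mxsim m (X : 'M[F]_m) : exists (r n : nat) (A : 'M[F]_r)
  (N : 'M[F]_n), [/\ A \in unitmx, nilpotent_mx N & mxsim X (dsum A N)].
Proof.
elim: m X => [|m IH] X.
  exists 0%N, 0%N, X, 0; split; last exact: mxsim_unit.
    by rewrite (_ : X = 1%:M) ?unitmx1// (flatmx0 X) [RHS]flatmx0.
  by exists 1%N; rewrite expr1.
have [Xu|/mxsim_singular[X' [x XX']]] := boolP (X \in unitmx).
  exists m.+1, 0%N, X, 0; split=> //; last exact: mxsim_unit.
  by exists 1%N; rewrite expr1.
have [r [n [A [N [Au Nn X'AN]]]]] := IH X'.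
have [Q _ /(_ x)] := mxsim_ext X'AN; rewrite -[Q *m x]vsubmxK => X'AN1.
exists r, (n + 1), A, (ext N (dsubmx (Q *m x))); split=> //.
  exact/nilpotent_ext.
apply: mxsim_trans XX' _; apply: mxsim_trans X'AN1 _; exact: mxsim_ext_dsum.
Qed.

(** For invertible [Y], the nonsingular type read through similarity instead of invariant
    subspaces. *)
Definition has_type (s : nat) (Y : 'M[F]_s) (m : nat) (X : 'M[F]_m) :=
  exists (n : nat) (N : 'M[F]_n), nilpotent_mx N /\ mxsim X (dsum Y N).

Lemma has_type_mxsim s (Y : 'M[F]_s) m n (X : 'M[F]_m) (Z : 'M[F]_n) :
  mxsim X Z -> has_type Y X -> has_type Y Z.
Proof.
move=> XZ [k [N [Nn XYN]]]; exists k, N; split=> //.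
exact: mxsim_trans (mxsim_sym XZ) XYN.
Qed.

(** A border is absorbed by the nilpotent block. For the direct implication [X] is split first;
    uniqueness of the splitting of [ext X x] identifies its invertible block with [Y]. This is why
    the type of the corners stabilizes. *)
Lemma has_type_ext s (Y : 'M[F]_s) m (X : 'M[F]_m) (x : 'cV[F]_m) :
  Y \in unitmx -> has_type Y (ext X x) <-> has_type Y X.
Proof.
move=> Yu; split=> [|[n [N [Nn XYN]]]]; last first.
  have [Q _ /(_ x)] := mxsim_ext XYN; rewrite -[Q *m x]vsubmxK => X'YN.
  exists (n + 1), (ext N (dsubmx (Q *m x))); split; first exact/nilpotent_ext.
  exact: mxsim_trans X'YN (mxsim_ext_dsum _ _ _ Yu).
have [r [n [A [N [Au Nn XAN]]]]] := fitting_mxsim X.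
have [Q _ /(_ x)] := mxsim_ext XAN; rewrite -[Q *m x]vsubmxK => X'AN.
have {}X'AN := mxsim_trans X'AN (mxsim_ext_dsum _ _ _ Au).
move=> [k [N' [Nn' XYN']]].
have [AY _] := mxsim_dsum_inv Au Yu ((nilpotent_ext _ _).2 Nn) Nn'
  (mxsim_trans (mxsim_sym X'AN) XYN').
exists n, N; split=> //; apply: mxsim_trans XAN _.
exact: mxsim_dsum AY (mxsim_refl N).
Qed.

(* Only the component of [x] along the nilpotent block matters, whence the
   factor [q ^ s]. *)
Lemma sum_ext_dsum (V : nmodType) (f : forall n, 'M[F]_n -> V) s
    (Y : 'M[F]_s) n (N : 'M[F]_n) m (X : 'M[F]_m) :
  (forall m n (X : 'M[F]_m) (Z : 'M[F]_n), mxsim X Z -> f m X = f n Z) ->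
  Y \in unitmx -> mxsim X (dsum Y N) ->
  \sum_x f (m + 1)%N (ext X x) =
    (\sum_x f (s + (n + 1))%N (dsum Y (ext N x))) *+ #|F| ^ s.
Proof.
move=> f_sim Yu XYN; have [Q [P [PQ QP]] XQ] := mxsim_ext XYN.
transitivity (\sum_z f (s + n + 1)%N (ext (dsum Y N) z)).
  rewrite (reindex (mulmx P)) /=; last first.
    by exists (mulmx Q) => x _; rewrite mulmxA ?PQ ?QP mul1mx.
  by apply: eq_bigr => z _; rewrite (f_sim _ _ _ _ (XQ _)) mulmxA QP mul1mx.
rewrite (reindex (fun p : 'cV_s * 'cV_n => col_mx p.1 p.2)) /=; last first.
  exists (fun z => (usubmx z, dsubmx z)) => [[z1 z2] _|z _] /=.
    by rewrite col_mxKu col_mxKd.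
  exact: vsubmxK.
under eq_bigr do rewrite (f_sim _ _ _ _ (mxsim_ext_dsum _ _ _ Yu)).
rewrite -(pair_bigA _ (fun (z1 : 'cV_s) (z2 : 'cV_n) =>
  f (s + (n + 1))%N (dsum Y (ext N z2)))) /=.
by rewrite sumr_const card_mx muln1.
Qed.

End RectangularSimilarity.

(** * The nonsingular type *)

Section NonsingularType.
Variable F : finFieldType.

Lemma mxendE n (X : 'M[F]_n) v : mxend X v = X *m v.
Proof. by rewrite /mxend lfunE. Qed.

Lemma iter_mxend n (X : 'M[F]_n) k v : iter k (mxend X) v = X ^+ k *m v.
Proof.
elim: k => [|k IH]; first by rewrite expr0 (mul1mx v).
by rewrite iterS IH mxendE mulmxA exprS.
Qed.

Lemma mulmx_sum_cols m n (L : 'M[F]_(m, n)) (w : 'cV[F]_n) :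
  L *m w = \sum_j w j 0 *: col j L.
Proof.
apply/colP => i; rewrite summxE mxE; apply: eq_bigr => j _.
by rewrite !mxE mulrC.
Qed.

Definition colspace m n (L : 'M[F]_(m, n)) : {vspace 'cV[F]_m} :=
  limg (linfun (mulmx L)).

Lemma colspaceP m n (L : 'M[F]_(m, n)) v :
  reflect (exists w, v = L *m w) (v \in colspace L).
Proof.
apply: (iffP memv_imgP) => [[w _ ->]|[w ->]]; exists w; rewrite ?lfunE//.
exact: memvf.
Qed.

Lemma colspace_basis m n (L : 'M[F]_(m, n)) (U : 'M[F]_(n, m)) :
  U *m L = 1%:M -> basis_of (colspace L) [tuple col j L | j < n].
Proof.
move=> UL; rewrite /basis_of; apply/andP; split.
  rewrite eqEsubv; apply/andP; split.
    apply/span_subvP => _ /tnthP[j ->]; rewrite tnth_mktuple.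
    by apply/colspaceP; exists (delta_mx j 0); rewrite -colE.
  apply/subvP => _ /colspaceP[w ->]; rewrite mulmx_sum_cols memv_suml// => j _.
  by rewrite memvZ// memv_span//; apply/tnthP; exists j; rewrite tnth_mktuple.
apply/freeP => k k0 i; have : L *m (\col_j k j) = 0.
  rewrite mulmx_sum_cols -[RHS]k0; apply: eq_bigr => j _.
  by rewrite mxE -tnth_nth tnth_mktuple.
move=> /(congr1 (mulmx U)); rewrite mulmxA UL mul1mx mulmx0 => /colP/(_ i).
by rewrite !mxE.
Qed.

Definition tuple_mx m n (b : n.-tuple 'cV[F]_m) : 'M[F]_(m, n) :=
  \matrix_(i, j) tnth b j i 0.

Lemma col_tuple_mx m n (b : n.-tuple 'cV[F]_m) j :
  col j (tuple_mx b) = tnth b j.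
Proof. by apply/colP => i; rewrite !mxE. Qed.

Lemma tuple_mx_mul m n (b : n.-tuple 'cV[F]_m) w :
  tuple_mx b *m w = \sum_j w j 0 *: tnth b j.
Proof.
by rewrite mulmx_sum_cols; apply: eq_bigr => j _; rewrite col_tuple_mx.
Qed.

Lemma tuple_mx_mem m n (V : {vspace 'cV[F]_m}) (b : n.-tuple 'cV[F]_m) w :
  basis_of V b -> tuple_mx b *m w \in V.
Proof.
move=> bV; rewrite tuple_mx_mul memv_suml// => j _; rewrite memvZ//.
by rewrite (basis_mem bV) ?mem_tnth.
Qed.

Lemma tuple_mx_coord m n (V : {vspace 'cV[F]_m}) (b : n.-tuple 'cV[F]_m)
    (v : 'cV[F]_m) :
  basis_of V b -> v \in V -> v = tuple_mx b *m (\col_(j < n) coord b j v).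
Proof.
move=> bV vV; rewrite {1}(coord_basis bV vV) tuple_mx_mul.
by apply: eq_bigr => j _; rewrite mxE (tnth_nth 0).
Qed.

Lemma tuple_mx_inj m n (V : {vspace 'cV[F]_m}) (b : n.-tuple 'cV[F]_m)
    (w : 'cV[F]_n) :
  basis_of V b -> tuple_mx b *m w = 0 -> w = 0.
Proof.
move=> /andP[_ /freeP bfree]; rewrite tuple_mx_mul => w0; apply/colP => j.
rewrite (bfree (fun j => w j 0)) ?mxE// -[RHS]w0.
by apply: eq_bigr => i _; rewrite (tnth_nth 0).
Qed.

Lemma eq_cols m n (A B : 'M[F]_(m, n)) :
  (forall j, col j A = col j B) -> A = B.
Proof.
move=> AB; apply/matrixP => i j.
by have /colP/(_ i) := AB j; rewrite !mxE.
Qed.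

Lemma eq_mulmxcol m n (A B : 'M[F]_(m, n)) :
  (forall w : 'cV_n, A *m w = B *m w) -> A = B.
Proof. by move=> AB; apply: eq_cols => j; rewrite !colE. Qed.

(** Bases of [V'] and [V0] placed side by side are the columns of a matrix [P] that intertwines [X]
    with [dsum Y N], where [N] is the matrix of [X] on [V0]. *)
Lemma fitting_has_type n (X : 'M[F]_n) (V' V0 : {vspace 'cV[F]_n}) s
    (b : s.-tuple 'cV[F]_n) (Y : 'M[F]_s) :
  fitting X V' V0 -> basis_of V' b ->
  (forall j, mxend X (tnth b j) = \sum_i Y i j *: tnth b i) -> has_type Y X.
Proof.
move=> [[VV VI] [_ XV0] _ [k Xk]] bV' XY.
have cV0 := vbasisP V0; set c := vbasis V0 in cV0.
pose L := tuple_mx b; pose R := tuple_mx c.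
have XL : X *m L = L *m Y.
  apply: eq_cols => j; rewrite colE -mulmxA -colE col_tuple_mx -mxendE XY.
  rewrite colE -mulmxA -colE tuple_mx_mul.
  by apply: eq_bigr => i _; rewrite mxE.
pose N : 'M[F]_(\dim V0) := \matrix_(i, j) coord c i (X *m tnth c j).
have XR : X *m R = R *m N.
  apply: eq_cols => j; rewrite colE -mulmxA -colE col_tuple_mx.
  rewrite colE -mulmxA -colE (tuple_mx_coord cV0 (v := X *m _)).
    by congr (_ *m _); apply/colP => i; rewrite !mxE.
  rewrite -mxendE (subvP XV0)// memv_img// (basis_mem cV0)// mem_tnth//.
pose P := row_mx L R.
have P_inj (w : 'cV_(s + \dim V0)) : P *m w = 0 -> w = 0.
  rewrite -[w]vsubmxK mul_row_col => /eqP; rewrite addr_eq0 => /eqP LR.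
  have L0 : L *m usubmx w = 0.
    apply/eqP; have : L *m usubmx w \in (V' :&: V0)%VS.
      by rewrite memv_cap (tuple_mx_mem _ bV') LR memvN (tuple_mx_mem _ cV0).
    by rewrite VI memv0.
  rewrite (tuple_mx_inj bV' L0); move: LR; rewrite L0 => /esym/eqP.
  by rewrite oppr_eq0 => /eqP /(tuple_mx_inj cV0) ->; rewrite col_mx0.
have P_surj (v : 'cV_n) : exists w, P *m w = v.
  have : v \in (V' + V0)%VS by rewrite VV memvf.
  move=> /memv_addP[v1 v1V [v2 v2V ->]].
  rewrite (tuple_mx_coord bV' v1V) (tuple_mx_coord cV0 v2V).
  by eexists (col_mx _ _); rewrite mul_row_col.
(* Preimages of the standard basis give a right inverse of [P]; injectivity of [P] makes it
   two-sided, with no count of dimensions. *)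
have [q qP] := choice P_surj.
pose Q := tuple_mx [tuple q (delta_mx j 0) | j < n].
have PQ : P *m Q = 1%:M.
  apply: eq_cols => j; rewrite colE -mulmxA -colE col_tuple_mx tnth_mktuple qP.
  by rewrite [RHS]colE mul1mx.
have QP : Q *m P = 1%:M.
  apply: eq_mulmxcol => w; apply/eqP; rewrite -subr_eq0 -mulmxBl; apply/eqP.
  by apply: P_inj; rewrite mulmxA mulmxBr mulmxA PQ mul1mx mulmx1 subrr mul0mx.
exists (\dim V0), N; split; last first.
  exists P, Q; split=> //.
  by rewrite mul_mx_row mul_row_block !mulmx0 addr0 add0r XL XR.
exists k; apply: eq_mulmxcol => w; rewrite mul0mx; apply: (tuple_mx_inj cV0).
rewrite mulmxA -(expmx_mul _ XR) -mulmxA -iter_mxend; apply: Xk.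
exact: tuple_mx_mem.
Qed.

(** The two column blocks of [P] span [V'] and [V0], and the row blocks of [Q] give the coordinates
    along them. *)
Lemma has_type_fitting n (X : 'M[F]_n) s (Y : 'M[F]_s) :
  Y \in unitmx -> has_type Y X ->
  exists V' V0, fitting X V' V0 /\
  exists2 b : s.-tuple 'cV[F]_n, basis_of V' b &
    forall j, mxend X (tnth b j) = \sum_i Y i j *: tnth b i.
Proof.
move=> Yu [n' [N [[k Nk] [P [Q [PQ QP XP]]]]]].
pose L := lsubmx P; pose R := rsubmx P; pose U := usubmx Q; pose D := dsubmx Q.
have LURD : L *m U + R *m D = 1%:M by rewrite -mul_row_col hsubmxK vsubmxK.
move: QP; rewrite -[P]hsubmxK -[Q]vsubmxK mul_col_row scalar_mx_block.
move=> /eq_block_mx[UL UR DL DR].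
move: XP; rewrite -{1 2}[P]hsubmxK mul_mx_row mul_row_block !mulmx0 addr0 add0r.
move=> /eq_row_mx[XL XR].
exists (colspace L), (colspace R); split; last first.
  exists [tuple col j L | j < s]; first exact: colspace_basis UL.
  move=> j; rewrite tnth_mktuple mxendE colE mulmxA XL -mulmxA -colE.
  rewrite mulmx_sum_cols; apply: eq_bigr => i _; by rewrite tnth_mktuple mxE.
have XV' : (mxend X @: colspace L)%VS = colspace L.
  apply/eqP; rewrite eqEsubv; apply/andP; split; apply/subvP => v.
    move=> /memv_imgP[_ /colspaceP[w ->] ->]; apply/colspaceP; exists (Y *m w).
    by rewrite mxendE !mulmxA XL.
  move=> /colspaceP[w ->]; apply/memv_imgP; exists (L *m (invmx Y *m w)).
    by apply/colspaceP; eexists.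
  by rewrite mxendE mulmxA XL -mulmxA mulKVmx.
split.
- split.
    apply/eqP; rewrite eqEsubv subvf /=; apply/subvP => v _; apply/memv_addP.
    exists (L *m (U *m v)); first by apply/colspaceP; eexists.
    exists (R *m (D *m v)); first by apply/colspaceP; eexists.
    by rewrite !mulmxA -mulmxDl LURD mul1mx.
  apply/eqP; rewrite -subv0; apply/subvP => v; rewrite memv_cap memv0.
  move=> /andP[/colspaceP[w ->] /colspaceP[w' LR]].
  have -> : w = U *m (R *m w') by rewrite -LR mulmxA UL mul1mx.
  by rewrite [U *m _]mulmxA UR mul0mx mulmx0.
- rewrite XV' subvv; split=> //; apply/subvP => v.
  move=> /memv_imgP[_ /colspaceP[w ->] ->]; apply/colspaceP; exists (N *m w).
  by rewrite mxendE !mulmxA XR.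
- split=> // _ _ /colspaceP[w ->] /colspaceP[w' ->].
  rewrite !mxendE !mulmxA XL -!mulmxA => /(congr1 (mulmx U)).
  rewrite ![U *m (L *m _)]mulmxA UL !mul1mx => /(congr1 (mulmx (invmx Y))).
  by rewrite !mulKmx// => ->.
- exists k => _ /colspaceP[w ->].
  by rewrite iter_mxend mulmxA (expmx_mul _ XR) Nk mulmx0 mul0mx.
Qed.

(** Two members of the class are conjugate, so the representative [Y] may be fixed once and for
    all. *)
Lemma nonsing_typeP n (X : 'M[F]_n) (sigma : Sigma F)
    (Y : 'M[F]_(sdim sigma)) : sclass Y -> Y \in unitmx ->
  nonsing_type X sigma <-> has_type Y X.
Proof.
move=> cY Yu; split.
  move=> [V' [V0 [fit [b bV' [Y' cY' XY']]]]].
  have : has_type Y' X by exact: fitting_has_type fit bV' XY'.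
  have {cY'} : mxsim Y' Y.
    have [Z Zu cE] := sclassP sigma; move: cY cY'; rewrite cE.
    move=> [u /= uu <-] [v /= vu <-].
    exact: mxsim_trans (mxsim_conj _ vu) (mxsim_sym (mxsim_conj _ uu)).
  move=> YY' [m [N [Nn XN]]]; exists m, N; split=> //.
  exact: mxsim_trans XN (mxsim_dsum YY' (mxsim_refl N)).
move=> /(has_type_fitting Yu)[V' [V0 [fit [b bV' XY]]]].
by exists V', V0; split=> //; exists b => //; exists Y.
Qed.

End NonsingularType.

(** * Cylinders and the topology of [Linf] *)

Section Topology.
Variable F : finFieldType.
Implicit Types (M : Linf F) (m n k : nat).

Lemma cvg_coordinates (I : Type) (T : I -> topologicalType)
    (G : set_system (prod_topology T)) (f : prod_topology T) : Filter G ->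
  (forall i, (fun g : prod_topology T => g i) @ G --> f i) -> G --> f.
Proof.
move=> FG Gf; apply/cvg_sup => i A; rewrite nbhsE => -[B [[W oW <-] Wf] BA].
by apply: filterS BA _; apply: Gf; exact: open_nbhs_nbhs.
Qed.

Lemma nbhs_entries (A : infmx F) k :
  \forall A' \near A, forall i j : 'I_k, entry A' i j = entry A i j.
Proof.
apply: (@filter_forall _ 'I_k
  (fun i A' => forall j : 'I_k, entry A' i j = entry A i j) (nbhs A)) => i.
apply: (@filter_forall _ 'I_k
  (fun j A' => entry A' i j = entry A i j) (nbhs A)) => j.
have ci := @proj_continuous nat (fun=> {ptws nat -> discrete_topology F})  i A.
have cj := @proj_continuous nat (fun=> discrete_topology F) j (A i).
apply: (ci (fun r => r j = A i j)); apply: (cj (fun c => c = A i j)).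
exact: discrete_set1.
Qed.

(** Otherwise there are matrices outside [O] that agree with [A] on larger and larger corners; they
    converge to [A] entrywise, which is absurd. *)
Lemma nbhs_infmx (A : infmx F) (O : set (infmx F)) : nbhs A O ->
  exists k, forall A',
    (forall i j, (i < k)%N -> (j < k)%N -> entry A' i j = entry A i j) -> O A'.
Proof.
move=> MO; apply: contrapT => /forallNP noK.
have {noK} /choice [f fP] : forall k, exists A' : infmx F,
    (forall i j, (i < k)%N -> (j < k)%N ->
      entry A' i j = entry A i j) /\ ~ O A'.
  by move=> k; have /existsNP[A' /not_implyP[]] := noK k; exists A'.
have fM : f @ \oo --> A.
  apply: (@cvg_coordinates nat (fun=> {ptws nat -> discrete_topology F})) => i.
  apply: (@cvg_coordinates nat (fun=> discrete_topology F)) => j.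
  apply/discrete_cvg; exists (maxn i j).+1 => // k /=; rewrite gtn_max.
  by move=> /andP[ik jk]; apply: (fP k).1.
have [k _ /(_ k (leqnn k))] := fM _ MO; exact: (fP k).2.
Qed.

Lemma Linf_inj M M' : Lmx M = Lmx M' -> M = M'.
Proof.
by case: M M' => M LM [M' LM'] /= MM'; case: _ / MM' in LM' *; congr MkLinf.
Qed.

Lemma Ln_le m n (A : infmx F) : (m <= n)%N -> Ln m A -> Ln n A.
Proof. by move=> mn LM i j ji ni; apply: LM => //; exact: leq_trans ni. Qed.

Lemma cornerP n M M' :
  corner n M = corner n M' <->
  forall i j, (i < n)%N -> (j < n)%N -> entry M i j = entry M' i j.
Proof.
split=> [/matrixP MM' i j ni nj|MM']; last first.
  by apply/matrixP => i j; rewrite !mxE MM'.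
by have := MM' (Ordinal ni) (Ordinal nj); rewrite !mxE.
Qed.

Lemma corner_le m n M M' : (m <= n)%N -> corner n M = corner n M' ->
  corner m M = corner m M'.
Proof.
move=> mn /cornerP MM'; apply/cornerP => i j im jm.
by apply: MM'; apply: leq_trans mn.
Qed.

(** In a row [i < n] the condition concerns entries with [j <= i], all of which lie in the
    [n]-corner. *)
Lemma corner_Ln m n M M' : (m <= n)%N -> corner n M = corner n M' ->
  Ln m M -> Ln n M' -> Ln m M'.
Proof.
move=> mn /cornerP MM' LM LM' i j ji mi.
have [ni|ni] := leqP n i; first exact: LM'.
by rewrite -MM' ?LM// (leq_ltn_trans ji).
Qed.

Definition embmx n (Z : 'M[F]_n) : infmx F :=
  fun i j => match insub i, insub j with
             | Some i', Some j' => Z i' j'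
             | _, _ => 0
             end.

Lemma Ln_embmx n (Z : 'M[F]_n) : Ln n (embmx Z).
Proof. by move=> i j _ ni; rewrite /entry /embmx insubF// ltnNge ni. Qed.

(** A sample point of [cyl Z]: a set saturated for [n]-corners within [Ln n] is tested on these
    points only. *)
Definition emb n (Z : 'M[F]_n) : Linf F := MkLinf (ex_intro _ n (Ln_embmx Z)).

Lemma corner_emb n (Z : 'M[F]_n) : corner n (emb Z) = Z.
Proof.
by apply/matrixP => i j; rewrite mxE /entry /= /embmx !valK.
Qed.

Definition cyl n (X : 'M[F]_n) : set (Linf F) :=
  [set M : Linf F | Ln n M /\ corner n M = X].

Lemma cyl_emb n (X : 'M[F]_n) : cyl X (emb X).
Proof. by split; [exact: Ln_embmx|exact: corner_emb]. Qed.

(** The cylinders around [M] form a neighbourhood basis. When [M] is in [Ln n], a cylinder of larger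
    size around [M] is still inside [Ln n] by [corner_Ln], so the inductive limit topology is tested
    on a single piece. *)
Lemma Linf_openP (U : set (Linf F)) :
  open U <-> forall M, U M -> exists k, Ln k M /\ cyl (corner k M) `<=` U.
Proof.
have -> : open U = Linf_open U by [].
split=> [oU M UM|Ucyl m].
  have [n LM] := LmxP M; have [W oO OU] := oU n.
  pose incl M' (LM' : Ln n (Lmx M')) : set_type (@Ln F n) :=
    exist _ (Lmx M') (mem_set LM').
  have inclK M' LM' : Ln_incl (incl M' LM') = M' by exact: Linf_inj.
  have OM : W (Lmx M).
    have : (Ln_incl (n := n) @^-1` U) (incl M LM) by rewrite /= inclK.
    by rewrite -OU.
  have [k kO] := nbhs_infmx (open_nbhs_nbhs (conj oO OM)).
  exists (maxn n k); split=> [|M' [LM' MM']].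
    exact: Ln_le (leq_maxl _ _) LM.
  have LM'n : Ln n (Lmx M') by apply: corner_Ln LM LM'; rewrite ?leq_maxl.
  rewrite -(inclK M' LM'n).
  suff : (Ln_incl (n := n) @^-1` U) (incl M' LM'n) by [].
  rewrite -OU; apply: kO => i j ik jk; move/cornerP : MM'; apply.
    exact: leq_trans (leq_maxr _ _).
  exact: leq_trans (leq_maxr _ _).
rewrite openE => M UM; have [k [LkM kU]] := Ucyl _ UM.
have [K [mK kK]] : exists K, (m <= K)%N /\ (k <= K)%N.
  by exists (maxn m k); rewrite leq_maxl leq_maxr.
apply: (@filterS _ (nbhs M) _ (set_val @^-1`
    [set A : infmx F |
      forall i j : 'I_K, entry A i j = entry (set_val M) i j])).
  move=> M' MM'; apply: kU.
  have e : corner K (Ln_incl M) = corner K (Ln_incl M').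
    by apply/matrixP => i j; rewrite !mxE; exact/esym/MM'.
  split; last exact/esym/(corner_le kK e).
  apply: corner_Ln kK e LkM _; apply: Ln_le mK _; exact: set_valP.
exact: initial_continuous (nbhs_entries _ _).
Qed.

(** These are the finite unions of cylinders of size [n]. The saturated form makes Boolean
    operations and the passage to a larger [n] immediate. *)
Definition level n (B : set (Linf F)) :=
  B `<=` [set M : Linf F | Ln n M] /\
  forall M M', B M -> Ln n M' -> corner n M = corner n M' -> B M'.

Lemma level_le m n B : (m <= n)%N -> level m B -> level n B.
Proof.
move=> mn [BL BB]; split=> [M BM|M M' BM LM' MM']; first exact: Ln_le (BL _ BM).
apply: (BB _ _ BM _ (corner_le mn MM')).
by apply: corner_Ln mn MM' (BL _ BM) LM'.
Qed.

Lemma level_cyl n (X : 'M[F]_n) : level n (cyl X).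
Proof. by split=> [M []//|M M' [LM <-] LM' MM']; split. Qed.

Lemma level0 n : level n set0. Proof. by split. Qed.

Lemma levelL n : level n [set M : Linf F | Ln n M]. Proof. by split. Qed.

Lemma levelU n A B : level n A -> level n B -> level n (A `|` B).
Proof.
move=> [AL AA] [BL BB]; split=> [M [|]|M M' ABM LM' MM'].
- exact: AL.
- exact: BL.
case: ABM => ABM.
  by left; exact: AA ABM LM' MM'.
by right; exact: BB ABM LM' MM'.
Qed.

Lemma levelD n A B : level n A -> level n B -> level n (A `\` B).
Proof.
move=> [AL AA] [BL BB]; split=> [M [AM _]|M M' [AM nBM] LM' MM'].
  exact: AL.
split; first exact: AA AM LM' MM'.
by move=> BM'; apply: nBM; apply: BB BM' (AL _ AM) (esym MM').
Qed.

Lemma levelI n A B : level n A -> level n B -> level n (A `&` B).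
Proof. by move=> lA lB; rewrite -setDD; do 2?apply: levelD. Qed.

Lemma level_bigcup n (I : Type) (P : set I) (A : I -> set (Linf F)) :
  (forall i, P i -> level n (A i)) -> level n (\bigcup_(i in P) A i).
Proof.
move=> lA; split=> [M [i Pi AM]|M M' [i Pi AM] LM' MM'].
  exact: (lA i Pi).1.
by exists i => //; apply: (lA i Pi).2 AM LM' MM'.
Qed.

Lemma level_open n B : level n B -> open B.
Proof.
move=> [BL BB]; apply/Linf_openP => M BM; exists n; split; first exact: BL.
by move=> M' [LM' MM']; apply: BB BM LM' (esym MM').
Qed.

Lemma level_closed n B : level n B -> closed B.
Proof.
move=> lB; rewrite -[B]setCK; apply: open_closedC; apply/Linf_openP => M nBM.
have [m LM] := LmxP M; have [K [mK nK]] : exists K, (m <= K)%N /\ (n <= K)%N.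
  by exists (maxn m n); rewrite leq_maxl leq_maxr.
exists K; split; first exact: Ln_le LM.
move=> M' [LM' MM'] BM'; apply: nBM.
by apply: (level_le nK lB).2 BM' _ MM'; exact: Ln_le LM.
Qed.

(* [Ln n] is a retract of the compact product space of all infinite matrices,
   under the truncation of the lower rows. *)
Lemma compact_Ln n : compact [set M : Linf F | Ln n M].
Proof.
pose r (A : infmx F) : infmx F :=
  fun i j => if (j <= i)%N && (n <= i)%N then 0 else A i j.
have Lr A : Ln n (r A) by move=> i j ji ni; rewrite /entry /r ji ni.
pose rL A : Linf F := MkLinf (ex_intro _ n (Lr A)).
have -> : [set M : Linf F | Ln n M] = rL @` setT.
  apply/seteqP; split=> [M LM|_ [A _ <-]]; last exact: Lr.
  exists (Lmx M) => //; apply: Linf_inj; apply/funext => i; apply/funext => j.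
  by rewrite /= /r; case: ifP => // /andP[ji ni]; rewrite -(LM i j).
apply: continuous_compact; last first.
  have := @tychonoff nat (fun=> {ptws nat -> discrete_topology F}) (fun=> setT).
  rewrite (_ : [set f | _] = setT); last exact/seteqP.
  apply=> _.
  have := @tychonoff nat (fun=> discrete_topology F) (fun=> setT).
  rewrite (_ : [set f | _] = setT); last exact/seteqP.
  apply=> _; apply: finite_compact; exact: finite_finset.
apply: continuous_subspaceT => A U; rewrite nbhsE => -[V [oV VA] VU].
have [k [LkA kV]] := (Linf_openP V).1 oV _ VA.
pose K := maxn n k; have kK : (k <= K)%N := leq_maxr n k.
apply: filterS (nbhs_entries A K) => A' AA'; apply: VU; apply: kV.
have e : corner K (rL A) = corner K (rL A').
  apply/matrixP => i j; rewrite !mxE /entry /= /r.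
  by case: ifP => // _; exact/esym/AA'.
split; last exact/esym/(corner_le kK e).
by apply: corner_Ln kK e LkA _; exact: Ln_le (leq_maxl n k) (Lr A').
Qed.

Lemma level_compact n B : level n B -> compact B.
Proof.
move=> lB; apply: (subclosed_compact _ (@compact_Ln n)); last exact: lB.1.
exact: level_closed lB.
Qed.

(** Two matrices with a different entry are separated by cylinders whose size exceeds both indices.
    Compact sets are therefore closed, hence Borel. *)
Lemma Linf_hausdorff : hausdorff_space (Linf F).
Proof.
rewrite open_hausdorff => M M' MM'.
have [i [j nij]] : exists i j, entry M i j <> entry M' i j.
  apply: contrapT => h; case/eqP: MM'; apply: Linf_inj.
  apply/funext => i; apply/funext => j; apply: contrapT => nij.
  by apply: h; exists i, j.
have [m LM] := LmxP M; have [m' LM'] := LmxP M'.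
pose K := maxn (maxn m m') (maxn i j).+1.
have [iK jK] : (i < K)%N /\ (j < K)%N.
  by rewrite !leq_max !ltnS !leq_max !leqnn !orbT.
have LKM : Ln K M by apply: Ln_le LM; rewrite !leq_max leqnn.
have LKM' : Ln K M' by apply: Ln_le LM'; rewrite !leq_max leqnn orbT.
exists (cyl (corner K M), cyl (corner K M')) => /=.
  by split; rewrite inE; split.
split.
- exact: level_open (level_cyl _).
- exact: level_open (level_cyl _).
- apply/eqP/seteqP; split=> // A [[_ AM] [_ AM']].
  by move: AM' => /=; rewrite AM => /cornerP/(_ i j iK jK).
Qed.

Lemma cyl_ext n (X : 'M[F]_n) : cyl X = \bigcup_(x in setT) cyl (ext X x).
Proof.
apply/seteqP; split=> M.
  move=> [LM MX]; exists (\col_i entry M i n) => //; split.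
    by apply: Ln_le LM; rewrite leq_addr.
  apply/matrixP => i j; rewrite -MX !mxE.
  case: splitP => i' ii'; rewrite !mxE; case: splitP => j' jj';
    rewrite !mxE ii' jj'//.
  - by rewrite ord1 addn0.
  - rewrite LM ?ord1 ?addn0//; exact: ltnW.
  - by rewrite LM ?ord1 ?addn0.
move=> [x _ [LM MX]].
(* [Ln (n + 1)] leaves row [n] unconstrained; the zero row of [ext X x] supplies the missing
   condition. *)
have LnM : Ln n M.
  move=> i j ji; rewrite leq_eqVlt => /predU1P[ni|ni]; last first.
    by apply: LM => //; rewrite addn1.
  have i1 : (i < n + 1)%N by rewrite addn1 -ni.
  have j1 : (j < n + 1)%N by exact: leq_ltn_trans i1.
  have /matrixP/(_ (Ordinal i1) (Ordinal j1)) := MX; rewrite !mxE /= => ->.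
  case: splitP => i' /= ii'.
    by have := leq_trans (ltn_ord i') (eq_leq ni); rewrite -ii' ltnn.
  by rewrite !mxE; case: splitP => j' _; rewrite mxE.
split=> //; apply/matrixP => i j.
move/matrixP: MX => /(_ (lshift 1 i) (lshift 1 j)).
by rewrite block_mxEul !mxE.
Qed.

End Topology.

(** * The ring of level sets *)

(** A copy of [Linf F] that carries the ring of level sets, kept apart from the Borel structure of
    [LinfB F]. *)
Definition LevelL (F : finFieldType) : Type := Linf F.

HB.instance Definition _ (F : finFieldType) := Pointed.on (LevelL F).

Definition level_sets (F : finFieldType) : set_system (LevelL F) :=
  [set B | exists n, level n B].

Definition level_display : measure_display. Proof. exact. Qed.

Lemma level_common (F : finFieldType) (A B : set (LevelL F)) :
  level_sets A -> level_sets B -> exists n, level n A /\ level n B.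
Proof.
move=> [m lA] [n lB]; exists (maxn m n); split.
  exact: level_le (leq_maxl _ _) lA.
exact: level_le (leq_maxr _ _) lB.
Qed.

Lemma level_sets0 (F : finFieldType) : @level_sets F set0.
Proof. by exists 0%N; exact: level0. Qed.

Lemma level_setsU (F : finFieldType) : setU_closed (@level_sets F).
Proof.
by move=> A B lA /(level_common lA)[n [lnA lnB]]; exists n; exact: levelU.
Qed.

Lemma level_setsD (F : finFieldType) : setD_closed (@level_sets F).
Proof.
by move=> A B lA /(level_common lA)[n [lnA lnB]]; exists n; exact: levelD.
Qed.

HB.instance Definition _ (F : finFieldType) :=
  isRingOfSets.Build level_display (LevelL F)
    (@level_sets0 F) (@level_setsU F) (@level_setsD F).

(** * The content determined by the masses of the cylinders *)

Section Content.
Variables (F : finFieldType) (R : realType) (phi : forall n, 'M[F]_n -> R).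
Hypothesis phi_ge0 : forall n (X : 'M[F]_n), 0 <= phi X.
Hypothesis phi_ext : forall n (X : 'M[F]_n), phi X = \sum_x phi (ext X x).

Lemma level_emb n (B : set (Linf F)) (Z : 'M[F]_n) M :
  level n B -> cyl Z M -> B M <-> B (emb Z).
Proof.
move=> [BL BB] [LM MZ]; split=> BM.
  by apply: (BB M (emb Z) BM (Ln_embmx Z)); rewrite corner_emb.
by apply: (BB _ _ BM LM); rewrite corner_emb.
Qed.

Definition corner_sum n (B : set (Linf F)) : R :=
  \sum_(Z : 'M[F]_n | `[< B (emb Z) >]) phi Z.

Lemma corner_sum_ge0 n B : 0 <= corner_sum n B.
Proof. by apply: sumr_ge0 => *; exact: phi_ge0. Qed.

Lemma cyl_ext_sub n (X : 'M[F]_n) x : cyl (ext X x) `<=` cyl X.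
Proof. by rewrite (cyl_ext X) => M MX; exists x. Qed.

(** Each term splits by [phi_ext]. The reindexing misses nothing: since [B] lies in [Ln n], a corner
    of size [n + 1] that counts has the form [ext Z x]. *)
Lemma corner_sumS n B : level n B -> corner_sum (n + 1) B = corner_sum n B.
Proof.
move=> lB; rewrite /corner_sum.
under [RHS]eq_bigr do rewrite phi_ext.
rewrite pair_big_dep /=.
rewrite (reindex_onto (fun p : 'M[F]_n * 'cV[F]_n => ext p.1 p.2)
    (fun W => (ulsubmx W, ursubmx W))) /=; last first.
  move=> W /asboolP BW; have LW : Ln n (emb W) by exact: lB.1.
  have [Z [x ->]] : exists Z x, W = ext Z x; last first.
    by rewrite block_mxKul block_mxKur.
  have : cyl (corner n (emb W)) (emb W) by split.
  rewrite cyl_ext => -[x _ [_]]; rewrite corner_emb => WE.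
  by exists (corner n (emb W)), x.
apply: eq_bigl => -[Z x] /=; rewrite block_mxKul block_mxKur eqxx !andbT.
by apply/asbool_equiv_eq/(level_emb lB)/(@cyl_ext_sub _ _ x)/cyl_emb.
Qed.

Lemma corner_sum_le m n B : (m <= n)%N -> level m B ->
  corner_sum n B = corner_sum m B.
Proof.
move=> /subnKC <- lB; elim: (n - m)%N => [|k IH]; first by rewrite addn0.
rewrite -IH addnS -addn1; apply: corner_sumS; apply: level_le lB.
exact: leq_addr.
Qed.

Lemma corner_sum_cyl n (X : 'M[F]_n) : corner_sum n (cyl X) = phi X.
Proof.
rewrite /corner_sum (big_pred1 X)// => Z; apply/asboolP/eqP => [[_ <-]|->].
  by rewrite corner_emb.
exact: cyl_emb.
Qed.

Lemma corner_sumU n A B : A `&` B = set0 ->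
  corner_sum n (A `|` B) = corner_sum n A + corner_sum n B.
Proof.
move=> AB0; rewrite /corner_sum big_mkcond [X in X + _]big_mkcond.
rewrite [X in _ + X]big_mkcond -big_split; apply: eq_bigr => Z _ /=.
have : ~ (A (emb Z) /\ B (emb Z)).
  by move=> ABZ; have : (A `&` B) (emb Z) by []; rewrite AB0.
rewrite asbool_or; case: asboolP => AZ; case: asboolP => BZ;
  rewrite ?addr0 ?add0r//.
by move=> /(_ (conj AZ BZ)).
Qed.

(** Some level of [B] is picked, and [content_ofE] shows that the choice is immaterial. Off the ring
    the default level 0 still gives a nonnegative value. *)
Definition content_of (B : set (LevelL F)) : \bar R :=
  (corner_sum (xget 0%N [set n | level n B]) B)%:E.

Lemma content_ofE n B : level n B -> content_of B = (corner_sum n B)%:E.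
Proof.
move=> lB; rewrite /content_of; case: xgetP => [m _ lmB|/(_ n)//].
rewrite -(corner_sum_le (leq_maxl m n) lmB).
by rewrite (corner_sum_le (leq_maxr m n) lB).
Qed.

Lemma content_of0 : content_of set0 = 0%E.
Proof.
rewrite (content_ofE (level0 F 0)) /corner_sum big_pred0// => Z.
by apply/asboolP.
Qed.

Lemma content_ofU A B : level_sets A -> level_sets B -> A `&` B = set0 ->
  content_of (A `|` B) = (content_of A + content_of B)%E.
Proof.
move=> lA /(level_common lA)[n [lnA lnB]] AB0.
rewrite (content_ofE lnA) (content_ofE lnB) (content_ofE (levelU lnA lnB)).
by rewrite corner_sumU.
Qed.

Lemma content_of_bigsetU (A : nat -> set (LevelL F)) n :
  (forall i, level_sets (A i)) -> trivIset setT A ->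
  (\sum_(0 <= i < n) content_of (A i))%E =
    content_of (\big[setU/set0]_(0 <= i < n) A i).
Proof.
move=> lA tA; elim: n => [|n IH]; first by rewrite !big_nil content_of0.
rewrite !big_nat_recr//= IH content_ofU//.
  by apply: (@bigsetU_measurable _ (LevelL F)) => i _; exact: lA.
rewrite big_mkord -bigcup_mkord setI_bigcupl bigcup0// => i /= ni.
by move/trivIsetP : tA; apply => //; rewrite ltn_eqF.
Qed.

(* By compactness a level set is never an infinite disjoint union of nonempty
   level sets. *)
Lemma content_of_sigma_additive : semi_sigma_additive content_of.
Proof.
move=> A lA tA lUA; have [n lUAn] := lUA.
have := level_compact lUAn; rewrite compact_cover => /(_ nat setT A)[].
- by move=> i _; have [m] := lA i; exact: level_open.
- by [].
move=> D _ AD; pose k := (\max_(i <- D) i).+1.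
apply: cvg_near_cst; exists k => // m km /=.
rewrite content_of_bigsetU//; congr content_of.
rewrite big_mkord -bigcup_mkord; apply/seteqP; split=> [M [i _ AM]|M /AD].
  by exists i.
move=> [i iD AM]; exists i => //=; apply: leq_trans km.
by rewrite ltnS; apply: leq_bigmax_seq.
Qed.

Definition content_measure : {measure set (LevelL F) -> \bar R} :=
  HB.pack content_of (isMeasure.Build _ (LevelL F) R content_of content_of0
    (fun B => corner_sum_ge0 _ B) content_of_sigma_additive).

End Content.

(** * Borel measures on [Linf] *)

Section BorelMeasures.
Variables (F : finFieldType) (R : realType).
Implicit Types (mu nu : {measure set (LinfB F) -> \bar R}).

(* An arbitrary union of sets of level [n] again has level [n], so every open
   set is a countable union of level sets. *)
Lemma measurable_LinfE :
  @measurable _ (LinfB F) = <<s @level_sets F >>.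
Proof.
apply/seteqP; split.
  apply: smallest_sub; first exact: smallest_sigma_algebra.
  move=> U oU.
  pose V n := \bigcup_(Z in [set Z : 'M[F]_n | cyl Z `<=` U]) cyl Z.
  have -> : U = \bigcup_n V n.
    apply/seteqP; split=> [M UM|M [n _ [Z ZU]]]; last exact: ZU.
    have [k [LM kU]] := (Linf_openP U).1 oU _ UM.
    by exists k => //; exists (corner k M) => //; split.
  apply: sigma_algebra_bigcup => n.
  apply: sub_sigma_algebra; exists n; apply: level_bigcup => Z _.
  exact: level_cyl.
apply: smallest_sub; first exact: smallest_sigma_algebra.
by move=> B [n lB]; apply: sub_sigma_algebra; exact: level_open lB.
Qed.

Lemma level_measurable n (B : set (LinfB F)) : level n B -> measurable B.
Proof. by move=> /level_open oB; exact: sub_sigma_algebra. Qed.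

Lemma cyl_measurable n (X : 'M[F]_n) : measurable (cyl X : set (LinfB F)).
Proof. exact: level_measurable (level_cyl X). Qed.

(** Caratheodory extension of the content. It is a measure on the sigma-algebra generated by the
    level sets, which is the Borel one, so it is repackaged on [LinfB F]. *)
Lemma exists_measure (phi : forall n, 'M[F]_n -> R) :
  (forall n (X : 'M[F]_n), 0 <= phi n X) ->
  (forall n (X : 'M[F]_n), phi n X = \sum_x phi (n + 1)%N (ext X x)) ->
  exists mu, forall n (X : 'M[F]_n), mu (cyl X) = (phi n X)%:E.
Proof.
move=> phi_ge0 phi_ext; pose m := content_measure phi_ge0 phi_ext.
pose f : set (LinfB F) -> \bar R := measure_extension m.
have f0 : f set0 = 0%E by exact: measure0.
have fge0 A : (0 <= f A)%E by exact: measure_ge0.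
have fsig : semi_sigma_additive f.
  move=> A mA tA mUA.
  apply: (@measure_semi_sigma_additive _ _ _ (measure_extension m)) => //.
    by move=> i; have := mA i; rewrite measurable_LinfE.
  by move: mUA; rewrite measurable_LinfE.
pose mu : {measure set (LinfB F) -> \bar R} :=
  HB.pack f (isMeasure.Build _ (LinfB F) R f f0 fge0 fsig).
exists mu => n X; rewrite [LHS]/=.
rewrite /f /measure_extension measurable_mu_extE; last first.
  by exists n; exact: level_cyl.
by rewrite /= (content_ofE phi_ext (level_cyl X)) corner_sum_cyl.
Qed.

Lemma cyl_trivIset n (D : set 'M[F]_n) : trivIset D (@cyl F n).
Proof. by move=> X Z _ _ [M [[_ <-] [_ <-]]]. Qed.

Lemma level_bigcup_cyl n (B : set (Linf F)) : level n B ->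
  B = \bigcup_(Z in [set Z : 'M[F]_n | B (emb Z)]) cyl Z.
Proof.
move=> lB; apply/seteqP; split=> [M BM|M [Z /= BZ ZM]]; last first.
  exact/(level_emb lB ZM).
have ZM : cyl (corner n M) M by split=> //; exact: lB.1.
by exists (corner n M) => //=; apply/(level_emb lB ZM).
Qed.

Lemma measure_level mu n (B : set (Linf F)) : level n B ->
  mu B = (\sum_(Z \in [set Z : 'M[F]_n | B (emb Z)]) mu (cyl Z))%E.
Proof.
move=> lB; rewrite {1}(level_bigcup_cyl lB) measure_fin_bigcup//.
- exact: finite_finset.
- exact: cyl_trivIset.
- by move=> Z _; exact: cyl_measurable.
Qed.

Lemma measure_cyl_ext mu n (X : 'M[F]_n) :
  mu (cyl X) = (\sum_x mu (cyl (ext X x)))%E.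
Proof.
rewrite cyl_ext measure_fin_bigcup.
- rewrite (fsbigE _ _ (index_enum_uniq 'cV[F]_n))//; last first.
    by move=> x _; rewrite mem_index_enum.
  by apply: eq_bigl => x; rewrite in_setT.
- exact: finite_finset.
- by move=> x y _ _ [M [[_ Mx] [_]]]; rewrite Mx => /eq_block_mx[_ -> //].
- by move=> x _; exact: cyl_measurable.
Qed.

(** Level sets are stable under intersection, generate the Borel sets and contain the exhausting
    sequence [Ln n], of finite mass. Large cylinders suffice because a level can always be
    raised. *)
Lemma meas_eq_cyl mu nu : (forall n (X : 'M[F]_n), mu (cyl X) < +oo)%E ->
  (exists k, forall n (X : 'M[F]_n), (k <= n)%N -> mu (cyl X) = nu (cyl X)) ->
  meas_eq mu nu.
Proof.
move=> mu_fin [k mu_nu] A mA.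
apply: (@measure_unique _ R (LinfB F) (@level_sets F)
  (fun n => [set M : Linf F | Ln n M])) => //.
- exact: measurable_LinfE.
- by move=> B C lB /(level_common lB)[n [lnB lnC]]; exists n; exact: levelI.
- by move=> n; exists n; exact: levelL.
- by apply/seteqP; split=> // M _; have [n LM] := LmxP M; exists n.
- move=> B [m lB]; have {}lB := level_le (leq_maxl m k) lB.
  rewrite !(measure_level _ lB); apply: eq_fsbigr => Z _.
  by apply: mu_nu; exact: leq_maxr.
- move=> n; rewrite (measure_level _ (levelL F n)) fsbig_finite//=.
  by apply: lte_sum_pinfty => Z _; exact: mu_fin.
Qed.

(** Cylinders are compact. Conversely the open sets [Ln n] increase to the whole space, so a compact
    set lies in one of them, a finite union of cylinders. *)
Lemma radonP mu : radon mu <-> forall n (X : 'M[F]_n), (mu (cyl X) < +oo)%E.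
Proof.
split=> [radon_mu n X|mu_fin K Kc].
  exact: radon_mu (level_compact (level_cyl X)).
have := Kc; rewrite compact_cover.
move=> /(_ nat setT (fun n => [set M : Linf F | Ln n M]))[].
- by move=> n _; exact: level_open (levelL F n).
- by move=> M _; have [n LM] := LmxP M; exists n.
move=> D _ KD; pose k := (\max_(i <- D) i)%N.
have Kk : K `<=` [set M : Linf F | Ln k M].
  by move=> M /KD[i iD]; apply: Ln_le; apply: leq_bigmax_seq.
apply: (@le_lt_trans _ _ (mu [set M : Linf F | Ln k M])).
  apply: le_measure => //; rewrite inE; last first.
    exact: level_measurable (levelL F k).
  rewrite -[K]setCK; apply: measurableC; apply: sub_sigma_algebra.
  exact: closed_openC (compact_closed (@Linf_hausdorff F) Kc).
rewrite (measure_level _ (levelL F k)) fsbig_finite//=.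
by apply: lte_sum_pinfty => Z _; exact: mu_fin.
Qed.

(** Membership in [S] can be read on any corner whose size is a level of the matrix. *)
Definition corner_class (S : set (LinfB F)) (T : forall n, 'M[F]_n -> Prop) :=
  forall n (X : 'M[F]_n) M, cyl X M -> S M <-> T n X.

(** The complement of [S] is the countable union of the cylinders whose corner fails [T]. *)
Lemma support_cyl mu S T : corner_class S T ->
  mu (~` S) = 0%E <-> forall n (X : 'M[F]_n), ~ T n X -> mu (cyl X) = 0%E.
Proof.
move=> ST; pose V n := \bigcup_(Z in [set Z : 'M[F]_n | ~ T n Z]) cyl Z.
have lV n : level n (V n) by apply: level_bigcup => Z _; exact: level_cyl.
have SV : ~` S = \bigcup_n V n.
  apply/seteqP; split=> [M nSM|M [n _ [Z /= nTZ ZM]]]; last first.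
    by move=> SM; apply: nTZ; apply/ST/SM.
  have [n LM] := LmxP M; have ZM : cyl (corner n M) M by split.
  exists n => //; exists (corner n M) => //= TZ; apply: nSM.
  exact/(ST _ _ _ ZM).
have mS : measurable (~` S).
  rewrite SV; apply: bigcupT_measurable => n; exact: level_measurable (lV n).
split=> [S0 n X nTX|T0].
  apply: (@subset_measure0 _ _ _ mu _ (~` S)) => //.
    exact: cyl_measurable.
  by move=> M XM SM; apply: nTX; apply/(ST _ _ _ XM).
apply/(measure_negligible mS); rewrite SV.
apply: negligible_bigcup => n; apply/negligibleP.
  exact: level_measurable (lV n).
rewrite measure_fin_bigcup//.
- by apply: fsbig1 => Z /= nTZ; exact: T0.
- exact: finite_finset.
- exact: cyl_trivIset.
- by move=> Z _; exact: cyl_measurable.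
Qed.

End BorelMeasures.

(** * The action of the infinite linear group *)

Section Action.
Variables (F : finFieldType) (R : realType).
Implicit Types (mu : {measure set (LinfB F) -> \bar R}).

Lemma fsbig_nat_ord (V : nmodType) (f : nat -> V) n :
  (forall k, (n <= k)%N -> f k = 0) ->
  \sum_(k \in [set: nat]) f k = \sum_(k < n) f k.
Proof.
move=> f0; rewrite (fsbigE _ _ (iota_uniq 0 n))//; last first.
  by move=> k _; rewrite mem_iota add0n /= -leqNgt => /f0.
under eq_bigl do rewrite in_setT.
by rewrite -(big_mkord xpredT) /index_iota subn0.
Qed.

Lemma fsbig_nat_single (V : nmodType) (f : nat -> V) i :
  (forall k, k != i -> f k = 0) -> \sum_(k \in [set: nat]) f k = f i.
Proof.
move=> f0; rewrite (@fsbigE _ _ _ _ _ [:: i])//; last first.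
  by move=> k _; rewrite inE => /f0.
by rewrite big_cons big_nil in_setT /= addr0.
Qed.

Lemma diag1_in n (u : 'M[F]_n) (i j : 'I_n) : entry (diag1 u) i j = u i j.
Proof. by rewrite /entry /diag1 !valK. Qed.

Lemma infmul_diag1l_in n (u : 'M[F]_n) (A : infmx F) (i : 'I_n) j :
  entry (infmul (diag1 u) A) i j = \sum_(k < n) u i k * entry A k j.
Proof.
rewrite [LHS](@fsbig_nat_ord _ _ n).
  by apply: eq_bigr => k _; rewrite diag1_in.
move=> k nk; rewrite diag1_out; last by rewrite leq_max nk orbT.
by rewrite ltn_eqF ?mul0r// (leq_trans (ltn_ord i)).
Qed.

Lemma infmul_diag1l_out n (u : 'M[F]_n) (A : infmx F) i j : (n <= i)%N ->
  entry (infmul (diag1 u) A) i j = entry A i j.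
Proof.
move=> ni; rewrite [LHS](@fsbig_nat_single _ _ i).
  by rewrite diag1_out ?leq_max ?ni// eqxx mul1r.
by move=> k ki; rewrite diag1_out ?leq_max ?ni// eq_sym (negbTE ki) mul0r.
Qed.

Lemma infmul_diag1r_in n (u : 'M[F]_n) (A : infmx F) i (j : 'I_n) :
  entry (infmul A (diag1 u)) i j = \sum_(k < n) entry A i k * u k j.
Proof.
rewrite [LHS](@fsbig_nat_ord _ _ n).
  by apply: eq_bigr => k _; rewrite diag1_in.
move=> k nk; rewrite diag1_out; last by rewrite leq_max nk.
by rewrite gtn_eqF ?mulr0// (leq_trans (ltn_ord j)).
Qed.

Lemma infmul_diag1r_out n (u : 'M[F]_n) (A : infmx F) i j : (n <= j)%N ->
  entry (infmul A (diag1 u)) i j = entry A i j.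
Proof.
move=> nj; rewrite [LHS](@fsbig_nat_single _ _ j).
  by rewrite diag1_out ?leq_max ?nj ?orbT// eqxx mulr1.
by move=> k kj; rewrite diag1_out ?leq_max ?nj ?orbT// (negbTE kj) mulr0.
Qed.

Lemma corner_GLact n (u : 'M[F]_n) (M : Linf F) :
  corner n (GLact u M) = u *m corner n M *m invmx u.
Proof.
apply/matrixP => i j; rewrite [LHS]mxE [LHS]infmul_diag1r_in [RHS]mxE.
apply: eq_bigr => k _; congr (_ * _); rewrite infmul_diag1l_in mxE.
by apply: eq_bigr => l _; rewrite mxE.
Qed.

(** In a row of index at least [n], the action only multiplies the first [n] entries on the right by
    [invmx u]; invertibility makes their vanishing equivalent before and after. *)
Lemma Ln_GLact n (u : 'M[F]_n) (M : Linf F) : u \in unitmx ->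
  Ln n (GLact u M) <-> Ln n M.
Proof.
move=> uu; split=> LM i j ji ni; last first.
  have [nj|jn] := leqP n j.
    by rewrite [LHS]infmul_diag1r_out// infmul_diag1l_out// LM.
  rewrite [LHS](infmul_diag1r_in _ _ _ (Ordinal jn)) big1// => k _.
  rewrite infmul_diag1l_out// LM ?mul0r//; apply: leq_trans ni; exact: ltnW.
have [nj|jn] := leqP n j.
  rewrite -[LHS](infmul_diag1l_out u)//.
  by rewrite -[LHS](infmul_diag1r_out (invmx u))// [LHS]LM.
pose r : 'rV_n := \row_k entry M i k.
have : r *m invmx u = 0.
  apply/rowP => k; rewrite !mxE -[RHS](LM i k)//; last first.
    by apply: leq_trans ni; exact: ltnW.
  rewrite [RHS]infmul_diag1r_in; apply: eq_bigr => l _.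
  by rewrite mxE infmul_diag1l_out.
move=> /(congr1 (mulmx^~ u)); rewrite mulmxKV// mul0mx.
move=> /rowP/(_ (Ordinal jn)).
by rewrite !mxE.
Qed.

Lemma GLact_preimage_cyl n (u Z : 'M[F]_n) : u \in unitmx ->
  GLact u @^-1` cyl Z = cyl (invmx u *m Z *m u).
Proof.
move=> uu; apply/seteqP; split=> M [/= LM MZ].
  split; first exact/(Ln_GLact _ uu).
  by rewrite -MZ corner_GLact -mulmxA mulmxKV// mulKmx.
split; first exact/(Ln_GLact _ uu).
by rewrite corner_GLact MZ mulmxA mulmxK// mulmxA mulmxV// mul1mx.
Qed.

Lemma dsum1_unit n k (u : 'M[F]_n) : u \in unitmx ->
  dsum u (1%:M : 'M[F]_k) \in unitmx /\
  invmx (dsum u (1%:M : 'M[F]_k)) = dsum (invmx u) 1%:M.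
Proof.
move=> uu; have AB : dsum u (1%:M : 'M[F]_k) *m dsum (invmx u) 1%:M = 1%:M.
  rewrite /dsum mulmx_block !(mulmx0, mul0mx, addr0, add0r, mulmx1).
  by rewrite mulmxV// -scalar_mx_block.
have [Au _] := mulmx1_unit AB; split=> //.
by rewrite -[RHS](mulKmx Au) AB mulmx1.
Qed.

Lemma diag1_dsum1 n k (u : 'M[F]_n) : diag1 (dsum u (1%:M : 'M[F]_k)) = diag1 u.
Proof.
apply/funext => i; apply/funext => j.
rewrite -/(entry _ i j) -[RHS]/(entry _ i j).
have [nkij|] := leqP (n + k) (maxn i j).
  by rewrite !diag1_out// (leq_trans (leq_addr k n)).
rewrite gtn_max => /andP[ik jk].
rewrite (diag1_in _ (Ordinal ik) (Ordinal jk)) /dsum mxE.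
case: splitP => i' /= ii'; rewrite mxE; case: splitP => j' /= jj'.
- by rewrite ii' jj' diag1_in.
- rewrite mxE diag1_out; last by rewrite leq_max jj' leq_addr orbT.
  by rewrite ltn_eqF// ii' jj' (leq_trans (ltn_ord i'))// leq_addr.
- rewrite mxE diag1_out; last by rewrite leq_max ii' leq_addr.
  by rewrite gtn_eqF// ii' jj' (leq_trans (ltn_ord j'))// leq_addr.
- rewrite mxE diag1_out; last by rewrite leq_max ii' leq_addr.
  by rewrite ii' jj' eqn_add2l.
Qed.

(** Both matrices represent the same element of the direct limit, so [u] can be enlarged to the size
    of any given cylinder. *)
Lemma GLact_dsum1 n k (u : 'M[F]_n) : u \in unitmx ->
  GLact (dsum u (1%:M : 'M[F]_k)) = GLact u.
Proof.
move=> uu; apply/funext => M; apply: Linf_inj; rewrite /= /infconj.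
by rewrite (dsum1_unit k uu).2 !diag1_dsum1.
Qed.

Lemma GLact_measurable n (u : 'M[F]_n) (A : set (LinfB F)) : u \in unitmx ->
  measurable A -> measurable (GLact u @^-1` A : set (LinfB F)).
Proof.
move=> uu mA.
suff h : measurable_fun setT (GLact u : LinfB F -> LinfB F).
  by rewrite -[X in measurable X]setTI; exact: h.
apply: measurability (@measurable_LinfE F) _ => _ [B [m lB] <-].
rewrite setTI; have {}lB : level (n + m) B.
  by apply: level_le lB; rewrite leq_addl.
apply: (@level_measurable _ (n + m)).
rewrite (level_bigcup_cyl lB) preimage_bigcup; apply: level_bigcup => Z _.
rewrite -(GLact_dsum1 m uu) GLact_preimage_cyl; last exact: (dsum1_unit m uu).1.
exact: level_cyl.
Qed.

(** The action permutes the cylinders of a large size by conjugating their corners. For the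
    converse, the image measure of [mu] agrees with [mu] on all cylinders of size at least that of
    [u], which is enough by [meas_eq_cyl]. *)
Lemma GL_invariantP mu : (forall n (X : 'M[F]_n), mu (cyl X) < +oo)%E ->
  GL_invariant mu <->
  forall m n (X : 'M[F]_m) (Z : 'M[F]_n), mxsim X Z -> mu (cyl X) = mu (cyl Z).
Proof.
move=> mu_fin; split=> [inv m n X Z XZ|sim n u uu A mA].
  have mn := mxsim_size XZ; case: n / mn in Z XZ *.
  have [u uu ->] := mxsimP XZ.
  rewrite -(inv _ _ uu _ (cyl_measurable _)) GLact_preimage_cyl//.
  by rewrite !mulmxA mulVmx// mul1mx mulmxKV.
pose f (B : set (LinfB F)) := mu (GLact u @^-1` B).
have f0 : f set0 = 0%E by rewrite /f preimage_set0 measure0.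
have fge0 B : (0 <= f B)%E by exact: measure_ge0.
have fsig : semi_sigma_additive f.
  move=> B mB tB mUB; rewrite /f preimage_bigcup.
  apply: measure_semi_sigma_additive.
  - by move=> i; exact: GLact_measurable.
  - apply/trivIsetP => i j _ _ ij; rewrite -preimage_setI.
    by move/trivIsetP : tB => -> //; rewrite preimage_set0.
  - by rewrite -preimage_bigcup; exact: GLact_measurable.
pose nu : {measure set (LinfB F) -> \bar R} :=
  HB.pack f (isMeasure.Build _ (LinfB F) R f f0 fge0 fsig).
suff : meas_eq mu nu by move=> /(_ A mA) ->.
apply: meas_eq_cyl => //; exists n => m X nm.
move: X; rewrite -(subnKC nm); move: (m - n)%N => k X.
have [Uu _] := dsum1_unit k uu.
rewrite /= /f -(GLact_dsum1 k uu) GLact_preimage_cyl//.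
apply/sim/mxsim_sym; rewrite -{2}[dsum u _]invmxK.
by apply: mxsim_conj; rewrite unitmx_inv.
Qed.

End Action.

(** * Invariant cones *)

Section Cones.
Variables (F : finFieldType) (R : realType).
Implicit Types (mu nu : {measure set (LinfB F) -> \bar R}).
Implicit Types (T : forall n, 'M[F]_n -> Prop) (phi : forall n, 'M[F]_n -> R).

(** Harmonicity refers to the branching [X -> ext X x]: the mass of a corner is the total mass of
    its successors. *)
Definition harmonic T phi :=
  [/\ forall n (X : 'M[F]_n), 0 <= phi n X,
      forall n (X : 'M[F]_n), phi n X = \sum_x phi (n + 1)%N (ext X x),
      forall m n (X : 'M[F]_m) (Z : 'M[F]_n), mxsim X Z -> phi m X = phi n Z
    & forall n (X : 'M[F]_n), ~ T n X -> phi n X = 0].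

(** Together with [harmonic_cone], this identifies a cone with its arrays of masses; the Radon
    condition makes the masses finite, so [fine] loses nothing. *)
Lemma cone_harmonic S T mu : corner_class S T -> cone_on S mu ->
  exists2 phi, harmonic T phi &
    forall n (X : 'M[F]_n), mu (cyl X) = (phi n X)%:E.
Proof.
move=> ST [/radonP mu_fin inv S0].
have muE n (X : 'M[F]_n) : mu (cyl X) = (fine (mu (cyl X)))%:E.
  by rewrite fineK// ge0_fin_numE.
exists (fun n X => fine (mu (cyl X))) => //.
split=> [n X|n X|m n X Z XZ|n X TX].
- exact: fine_ge0.
- apply: EFin_inj; rewrite -muE measure_cyl_ext -sumEFin.
  by apply: eq_bigr => x _; rewrite -muE.
- by rewrite ((GL_invariantP mu_fin).1 inv _ _ _ _ XZ).
- by rewrite ((support_cyl mu ST).1 S0).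
Qed.

Lemma harmonic_cone S T phi : corner_class S T -> harmonic T phi ->
  exists2 mu, cone_on S mu &
    forall n (X : 'M[F]_n), mu (cyl X) = (phi n X)%:E.
Proof.
move=> ST [phi0 phi_ext phi_sim phiT].
have [mu muE] := exists_measure phi0 phi_ext; exists mu => //.
have mu_fin n (X : 'M[F]_n) : (mu (cyl X) < +oo)%E by rewrite muE ltry.
split; first exact/radonP.
- by apply/GL_invariantP => // m n X Z XZ; rewrite !muE (phi_sim _ _ _ _ XZ).
- by apply/(support_cyl mu ST) => n X /phiT; rewrite muE => ->.
Qed.

Lemma cone_meas_eq S T mu nu : corner_class S T ->
  cone_on S mu -> cone_on S nu ->
  (forall n (X : 'M[F]_n), T n X -> mu (cyl X) = nu (cyl X)) -> meas_eq mu nu.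
Proof.
move=> ST [/radonP mu_fin _ muS] [_ _ nuS] mu_nu.
apply: meas_eq_cyl => //; exists 0%N => n X _; have [TX|TX] := pselect (T n X).
  exact: mu_nu.
by rewrite ((support_cyl mu ST).1 muS)// ((support_cyl nu ST).1 nuS).
Qed.

Lemma cone_onD S mu nu : cone_on S mu -> cone_on S nu ->
  cone_on S (measure_add mu nu).
Proof.
move=> [mur mui muS] [nur nui nuS]; split.
- by move=> K Kc; rewrite [X in (X < _)%E]measure_addE lte_add_pinfty ?mur ?nur.
- move=> n u uu A mA; rewrite [LHS]measure_addE [RHS]measure_addE.
  by congr (_ + _)%E; [exact: mui|exact: nui].
- by rewrite [LHS]measure_addE muS nuS adde0.
Qed.

Lemma cone_onZ S (c : {nonneg R}) mu : cone_on S mu -> cone_on S (mscale c mu).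
Proof.
move=> [mur mui muS]; split.
- by move=> K Kc; rewrite /= /mscale lte_mul_pinfty// ?lee_fin// mur.
- by move=> n u uu A mA; rewrite /= /mscale mui.
- by rewrite /= /mscale muS mule0.
Qed.

(** From size [m] on, every corner is an [ext] of the preceding one. *)
Lemma corner_stable T m n (M : Linf F) :
  (forall n (X : 'M[F]_n) x, T (n + 1)%N (ext X x) <-> T n X) ->
  Ln m M -> (m <= n)%N -> T n (corner n M) <-> T m (corner m M).
Proof.
move=> T_ext LM /subnKC <-; elim: (n - m)%N => [|k IH]; first by rewrite addn0.
have : cyl (corner (m + k) M) M.
  by split=> //; apply: Ln_le LM; exact: leq_addr.
rewrite -IH addnS -addn1 cyl_ext => -[x _ [_ ->]].
exact: T_ext.
Qed.

Lemma NilL_corner_class : corner_class (@NilL F) (@nilpotent_mx F).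
Proof.
move=> n X M [LM MX]; rewrite -MX; split=> [[m [LmM Nm]]|]; last by exists n.
have stable := corner_stable (@nilpotent_ext F).
apply/(stable _ _ _ LM (leq_maxl n m)); exact/(stable _ _ _ LmM (leq_maxr n m)).
Qed.

Lemma Lsigma_corner_class (sigma : Sigma F) (Y : 'M[F]_(sdim sigma)) :
  sclass Y -> Y \in unitmx -> corner_class (Lsigma sigma) (has_type Y).
Proof.
move=> cY Yu n X M [LM MX]; rewrite -MX.
have stable k := corner_stable
  (fun n X x => @has_type_ext F _ Y n X x Yu) LM (n := k).
split=> [[k kM]|YM].
  apply/(stable (maxn n k) (leq_maxl n k))/(nonsing_typeP _ cY Yu).
  by apply: kM; exact: leq_maxr.
by exists n => k nk; apply/(nonsing_typeP _ cY Yu)/stable.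
Qed.

End Cones.

(** * Transfer of masses between nilpotent corners and corners of type [Y] *)

Section Transfer.
Variables (F : finFieldType) (R : realType) (s : nat) (Y : 'M[F]_s).
Hypothesis Yu : Y \in unitmx.
Implicit Types (phi psi : forall n, 'M[F]_n -> R).

Let c n : R := #|F|%:R ^+ (s * n).

Let c_gt0 n : 0 < c n.
Proof. by rewrite exprn_gt0// ltr0n; apply/card_gt0P; exists 0. Qed.

Let cS n : c (n + 1) = c n * #|F|%:R ^+ s.
Proof. by rewrite /c mulnDr muln1 exprD. Qed.

Let mulc (x : R) : x *+ #|F| ^ s = x * #|F|%:R ^+ s.
Proof. by rewrite -natrX mulr_natr. Qed.

Lemma harmonic_to_type phi : harmonic (@nilpotent_mx F) phi ->
  exists2 psi, harmonic (has_type Y) psi &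
    forall n (N : 'M[F]_n), nilpotent_mx N ->
      psi (s + n)%N (dsum Y N) = (c n)^-1 * phi n N.
Proof.
move=> [phi0 phi_ext phi_sim phiT].
(* The candidate values of [psi] at [X]. The nilpotent block is unique up to similarity and [phi] is
   a class function, so there is at most one; off the type of [Y] there is none and [xget] returns
   0. *)
pose val n (X : 'M[F]_n) := [set r : R | exists k (N : 'M[F]_k),
  [/\ nilpotent_mx N, mxsim X (dsum Y N) & r = (c k)^-1 * phi k N]].
pose psi n (X : 'M[F]_n) := xget 0 (val n X).
have psiE n (X : 'M[F]_n) k (N : 'M[F]_k) : nilpotent_mx N ->
    mxsim X (dsum Y N) -> psi n X = (c k)^-1 * phi k N.
  move=> Nn XYN; apply: xget_unique; first by exists k, N.
  move=> _ [k' [N' [Nn' XYN' ->]]].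
  have [_ NN'] := mxsim_dsum_inv Yu Yu Nn Nn'
    (mxsim_trans (mxsim_sym XYN) XYN').
  by rewrite (phi_sim _ _ _ _ NN') (mxsim_size NN').
have psi0 n (X : 'M[F]_n) : ~ has_type Y X -> psi n X = 0.
  move=> XY; rewrite /psi; case: xgetP => // r _ [k [N [Nn XYN _]]].
  by case: XY; exists k, N.
have psi_sim m n (X : 'M[F]_m) (Z : 'M[F]_n) : mxsim X Z -> psi m X = psi n Z.
  move=> XZ; have [[k [N [Nn XYN]]]|XY] := pselect (has_type Y X).
    rewrite (psiE _ _ _ _ Nn XYN).
    by rewrite (psiE _ _ _ _ Nn (mxsim_trans (mxsim_sym XZ) XYN)).
  by rewrite !psi0// => /(has_type_mxsim (mxsim_sym XZ)).
exists psi; last by move=> n N Nn; exact: psiE Nn (mxsim_refl _).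
split=> // n X.
  have [[k [N [Nn XYN]]]|XY] := pselect (has_type Y X); last by rewrite psi0.
  by rewrite (psiE _ _ _ _ Nn XYN) mulr_ge0// invr_ge0 ltW.
have [[k [N [Nn XYN]]]|XY] := pselect (has_type Y X); last first.
  rewrite psi0// big1// => x _; rewrite psi0//.
  by move=> /(has_type_ext _ _ Yu).
(* The factor [q ^ s] coming from the free upper part of the column cancels against
   [c (k + 1) = c k * q ^ s]. *)
rewrite (sum_ext_dsum psi_sim Yu XYN) (psiE _ _ _ _ Nn XYN).
under eq_bigr => x _.
  rewrite (psiE _ _ _ _ ((nilpotent_ext N x).2 Nn) (mxsim_refl _)).
  over.
rewrite -mulr_sumr -phi_ext mulc mulrAC cS invfM mulfVK//.
by rewrite gt_eqF// exprn_gt0// ltr0n; apply/card_gt0P; exists 0.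
Qed.

Lemma harmonic_of_type psi : harmonic (has_type Y) psi ->
  exists2 phi, harmonic (@nilpotent_mx F) phi &
    forall n (N : 'M[F]_n), nilpotent_mx N ->
      psi (s + n)%N (dsum Y N) = (c n)^-1 * phi n N.
Proof.
move=> [psi0 psi_ext psi_sim psiT].
pose phi n (N : 'M[F]_n) : R :=
  if pselect (nilpotent_mx N) then c n * psi (s + n)%N (dsum Y N) else 0.
have phiE n (N : 'M[F]_n) : nilpotent_mx N ->
    phi n N = c n * psi (s + n)%N (dsum Y N).
  by rewrite /phi; case: pselect.
have phi0 n (N : 'M[F]_n) : ~ nilpotent_mx N -> phi n N = 0.
  by rewrite /phi; case: pselect.
exists phi; last by move=> n N Nn; rewrite phiE// mulKf// gt_eqF.
split=> // [n N|n N|m n N N' NN'].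
- have [Nn|Nn] := pselect (nilpotent_mx N); last by rewrite phi0.
  by rewrite phiE// mulr_ge0// ltW.
- have [Nn|Nn] := pselect (nilpotent_mx N); last first.
    by rewrite phi0// big1// => x _; rewrite phi0// => /nilpotent_ext.
  under eq_bigr => x _ do rewrite (phiE _ _ ((nilpotent_ext N x).2 Nn)).
  rewrite phiE// -mulr_sumr cS psi_ext -mulrA; congr (_ * _).
  by rewrite (sum_ext_dsum psi_sim Yu (mxsim_refl _)) mulc mulrC.
- have [Nn|Nn] := pselect (nilpotent_mx N).
    rewrite !phiE//; last exact: mxsim_nil NN' Nn.
    rewrite (psi_sim _ _ _ _ (mxsim_dsum (mxsim_refl Y) NN')).
    by rewrite {1}(mxsim_size NN').
  by rewrite !phi0// => /(mxsim_nil (mxsim_sym NN')).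
Qed.

Implicit Types (mu nu : {measure set (LinfB F) -> \bar R}).

(** Only normal forms [dsum Y N] are compared: within the cones, invariance and the support
    condition fix the masses of all other cylinders. *)
Definition transfer mu nu := forall n (N : 'M[F]_n), nilpotent_mx N ->
  nu (cyl (dsum Y N)) = ((#|F|%:R ^+ (s * n))^-1%:E * mu (cyl N))%E.

Lemma transferD mu mu' nu nu' : transfer mu nu -> transfer mu' nu' ->
  transfer (measure_add mu mu') (measure_add nu nu').
Proof.
move=> mu_nu mu_nu' n N Nn; rewrite [LHS]measure_addE.
rewrite [X in (_ * X)%E]measure_addE mu_nu// mu_nu'//.
by rewrite ge0_muleDr.
Qed.

Lemma transferZ (r : {nonneg R}) mu nu : transfer mu nu ->
  transfer (mscale r mu) (mscale r nu).
Proof. by move=> mu_nu n N Nn; rewrite /= /mscale mu_nu// muleCA. Qed.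

Lemma transfer_inv mu nu n (N : 'M[F]_n) : transfer mu nu -> nilpotent_mx N ->
  mu (cyl N) = ((c n)%:E * nu (cyl (dsum Y N)))%E.
Proof.
move=> mu_nu Nn; rewrite mu_nu// muleA -EFinM mulfV ?mul1e//.
by rewrite gt_eqF// c_gt0.
Qed.

End Transfer.

(** * The affine isomorphism of the two cones *)

Theorem proposition5p5 (R : realType) (F : finFieldType) (sigma : Sigma F) :
  exists Phi : {measure set (LinfB F) -> \bar R} ->
               {measure set (LinfB F) -> \bar R},
    affine_iso (@P0 F R) (@Psigma F R sigma) Phi.
Proof.
have [Y Yu sE] := sclassP sigma.
have cY : sclass Y.
  rewrite sE; exists 1%:M; first exact: unitmx1.
  by rewrite invmx1 mul1mx mulmx1.
have nilC := @NilL_corner_class F; have sigC := Lsigma_corner_class cY Yu.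
pose rel := @transfer F R _ Y.
have from mu : P0 mu -> exists2 nu, Psigma sigma nu & rel mu nu.
  move=> /(cone_harmonic nilC)[phi].
  move=> /(harmonic_to_type Yu)[psi hpsi phi_psi] muE.
  have [nu nuS nuE] := harmonic_cone sigC hpsi; exists nu => // n N Nn.
  by rewrite nuE muE phi_psi.
have to nu : Psigma sigma nu -> exists2 mu, P0 mu & rel mu nu.
  move=> /(cone_harmonic sigC)[psi].
  move=> /(harmonic_of_type Yu)[phi hphi phi_psi] nuE.
  have [mu muS muE] := harmonic_cone nilC hphi; exists mu => // n N Nn.
  by rewrite nuE muE phi_psi.
(* The relation is one-to-one up to [meas_eq]: the factor is invertible, and by invariance a corner
   of type [Y] has the same mass as its normal form. *)
have rel_eq mu mu' nu nu' : P0 mu -> P0 mu' -> Psigma sigma nu ->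
    Psigma sigma nu' -> rel mu nu -> rel mu' nu' ->
    meas_eq nu nu' <-> meas_eq mu mu'.
  move=> mu0 mu0' nuS nuS' mu_nu mu_nu'; split=> e.
    apply: (cone_meas_eq nilC) => // n N Nn.
    rewrite (transfer_inv mu_nu Nn) (transfer_inv mu_nu' Nn) e//.
    exact: cyl_measurable.
  apply: (cone_meas_eq sigC) => // m X [n [N [Nn XYN]]].
  have sim_eq xi : Psigma sigma xi -> xi (cyl X) = xi (cyl (dsum Y N)).
    by move=> [/radonP xi_fin /(GL_invariantP xi_fin) + _]; exact.
  rewrite !sim_eq// mu_nu// mu_nu'// e//; exact: cyl_measurable.
(* Outside the cone the value of [Phi] is arbitrary; [mu] itself is taken. *)
have /choice [Phi PhiP] : forall mu, exists nu,
    P0 mu -> Psigma sigma nu /\ rel mu nu.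
  move=> mu; have [/from[nu nuS mu_nu]|mu0] := pselect (P0 mu).
    by exists nu.
  by exists mu.
exists Phi; split=> [mu mu0|mu nu mu0 nu0|nu nuS|mu nu mu0 nu0|r mu mu0].
- by have [] := PhiP _ mu0.
- have [muS mur] := PhiP _ mu0; have [nuS nur] := PhiP _ nu0.
  exact: rel_eq.
- have [mu mu0 mur] := to _ nuS; have [muS mur'] := PhiP _ mu0.
  by exists mu => //; apply/(rel_eq _ _ _ _ mu0 mu0 muS nuS mur' mur).
- have [muS mur] := PhiP _ mu0; have [nuS nur] := PhiP _ nu0.
  (* The sum is related both to its image and to the sum of the images, so [rel_eq] identifies these
     two; scaling is treated alike. *)
  have D0 := cone_onD mu0 nu0; have [DS Dr] := PhiP _ D0.
  by apply/(rel_eq _ _ _ _ D0 D0 DS (cone_onD muS nuS) Dr (transferD mur nur)).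
- have [muS mur] := PhiP _ mu0; have Z0 := cone_onZ r mu0.
  have [ZS Zr] := PhiP _ Z0.
  by apply/(rel_eq _ _ _ _ Z0 Z0 ZS (cone_onZ r muS) Zr (transferZ r mur)).
Qed.
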